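(* Let $\theta\in(0,1)$, $0<\Delta t<C_{\Delta t}$, and let $(u_n)_{n\ge0}$ be the velocity approximations of the fully implicit DLN scheme. If $N$ is large enough such that $$(N-1)\Delta t>T_*\big(\|u_0\|,\|u_1\|,\|f\|_\infty\big)=\frac{4C_\epsilon(\theta)}{\nu\lambda_1}\ln\Big(\frac{\widehat C_h(\theta)\big(\|u_1\|^2+\|u_0\|^2\big)}{\rho_0}\Big),$$ then $$\|u_N\|^2\le2\rho_0 .$$
   Context: Setting. $\Omega\subset\mathbb{R}^2$ is a domain with boundary of class $C^2$, $\nu>0$, $(\cdot,\cdot)$ and $\|\cdot\|$ are the $L^2(\Omega)$ inner product and norm. $H=\{v\in L^2(\Omega)^2:\nabla\cdot v=0,\ v\cdot\vec n|_{\partial\Omega}=0\}$, $V=\{v\in H_0^1(\Omega)^2:\nabla\cdot v=0\}$. $f\in L^\infty(\mathbb{R}_+;H)$, $\|f\|_\infty=\|f\|_{L^\infty(\mathbb{R}_+;H)}$. The Stokes operator $A:V\to V'$ is $\langle Au,v\rangle=(\nabla u,\nabla v)$; $\lambda_1>0$ is its smallest eigenvalue, so $\|u\|\le\lambda_1^{-1/2}\|\nabla u\|$ on $V$. $b(u,v,w)=(u\cdot\nabla v,w)$. DLN coefficients: $\alpha_2=\frac{\theta+1}{2}$, $\alpha_1=-\theta$, $\alpha_0=\frac{\theta-1}{2}$; $\beta_2=\frac{2+\theta-\theta^2}{4}$, $\beta_1=\frac{\theta^2}{2}$, $\beta_0=\frac{2-\theta-\theta^2}{4}$. For a sequence $(z_n)$,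 $z_{n,\beta}=\sum_{\ell=0}^2\beta_\ell z_{n-1+\ell}$; $t_n=n\Delta t$. DLN scheme: given $u_0,u_1\in V$, for $n\ge1$, $u_{n+1}\in V$ satisfies $\frac1{\Delta t}\sum_{\ell=0}^2\alpha_\ell u_{n-1+\ell}-\nu\Delta u_{n,\beta}+u_{n,\beta}\cdot\nabla u_{n,\beta}+\nabla p_{n,\beta}=f(t_{n,\beta})$, $\nabla\cdot u_{n,\beta}=0$, where $p$ is the pressure; in dual form, for all $v\in V$, $\frac1{\Delta t}\big(\sum_{\ell=0}^2\alpha_\ell u_{n-1+\ell},v\big)+\nu(\nabla u_{n,\beta},\nabla v)+b(u_{n,\beta},u_{n,\beta},v)=(f(t_{n,\beta}),v)$. $G$-norm: $\left\|\begin{matrix}u\\ v\end{matrix}\right\|_{G(\theta)}^2=\frac{1+\theta}{4}\|u\|^2+\frac{1-\theta}{4}\|v\|^2$. Let $a_1=-\sqrt{\theta(1-\theta^2)/2}$, $a_2=a_0=-\frac12a_1$. Time step bound: $C_{\Delta t}=\frac1{\nu\lambda_1}\min\big\{\frac{8\theta(1-\theta^2)}{8-6\theta^2+3\theta^4},2(1-\theta)\big\}$. Auxiliary quantities (the paper establishes that they exist when $\Delta t<C_{\Delta t}$): $C_h(\theta),C_\epsilon(\theta)>0$ depend only on $\theta$, and $\epsilon>0$, $a,b,c\in\mathbb{R}$, $h_{11},h_{22}>0$ (independent of $n$) are such that, with $\left\|\begin{matrix}u\\ v\end{matrix}\right\|_{H(\theta)}^2=h_{11}\|u\|^2+h_{22}\|v\|^2$,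 for all $n\ge1$ $\left\|\begin{matrix}u_{n+1}\\ u_n\end{matrix}\right\|_{G(\theta)}^2-\left\|\begin{matrix}u_n\\ u_{n-1}\end{matrix}\right\|_{G(\theta)}^2+\|\sum_{\ell=0}^2a_\ell u_{n-1+\ell}\|^2+\frac{\nu\Delta t\lambda_1}{2}\|u_{n,\beta}\|^2=(1+\epsilon)\left\|\begin{matrix}u_{n+1}\\ u_n\end{matrix}\right\|_{H(\theta)}^2-\left\|\begin{matrix}u_n\\ u_{n-1}\end{matrix}\right\|_{H(\theta)}^2+\|au_{n+1}+bu_n+cu_{n-1}\|^2$, and $h_{11}>\frac{\theta^3}{2}[1-\frac12\theta(1-\theta)]$, $h_{22}>\frac1{16}\theta(1-\theta)^2(1+\theta)(2+\theta)$, $\max\{h_{11},h_{22}\}<C_h(\theta)$, $\frac14<\frac1\epsilon<\frac{C_\epsilon(\theta)}{\nu\lambda_1\Delta t}$. Constants: $\widehat C_h(\theta)=\frac{C_h(\theta)}{\frac{\theta^3}{2}[1-\frac12\theta(1-\theta)]}$, $\quad\rho_0=\frac{C_\epsilon(\theta)}{\nu^2\lambda_1^2\theta^3[1-\frac12\theta(1-\theta)]}\|f\|_\infty^2$.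
   Formalization: Point values f(t_{n,β}) of a class f in L^∞(R_+;H) are undefined, so a representative of f with values in H is fixed and ‖f(t_{n,β})‖ ≤ ‖f‖_∞ is assumed for all n ≥ 1; otherwise values of f on a null set would falsify the bound. *)

(* Defs.v *)
From HB Require Import structures.
From mathcomp Require Import all_boot all_order all_algebra.
From mathcomp Require Import all_classical all_reals all_analysis.
From mathcomp Require Import ess_sup_inf.

Set Implicit Arguments.
Unset Strict Implicit.
Unset Printing Implicit Defensive.

Import Order.TTheory GRing.Theory Num.Theory.
Import numFieldNormedType.Exports.

Local Open Scope classical_set_scope.
Local Open Scope ring_scope.

(* Functions on Omega are represented by functions on the whole plane; every
   notion below only looks at their values on Omega, up to null sets. *)
Definition vfield (R : realType) : Type := R * R -> R * R.
(* Gradient of a vector field v: the rows (Dv x).1 and (Dv x).2 are the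
   gradients of the two components of v. *)
Definition gfield (R : realType) : Type := R * R -> (R * R) * (R * R).

Section Plane.
Context {R : realType}.

Definition mu2 : {measure set (measurableTypeR R * measurableTypeR R) -> \bar R} :=
  (@lebesgue_measure R \x @lebesgue_measure R)%E.

Definition dot (x y : R * R) : R := x.1 * y.1 + x.2 * y.2.

Fixpoint Ck (V : normedModType R) (k : nat) (f : V -> R) : Prop :=
  match k with
  | 0 => continuous f
  | k'.+1 => (forall x, differentiable f x) /\ forall v, Ck k' ('D_v f)
  end.

Definition grad (phi : R * R -> R) (x : R * R) : R * R :=
  ('D_((1, 0) : R * R) phi x, 'D_((0, 1) : R * R) phi x).

(* Near each boundary point, in suitable orthonormal coordinates
   (y . e^perp, y . e), Omega is the strict epigraph of a C^2 function. *)
Definition C2_boundary (Omega : set (R * R)) : Prop :=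
  forall x, (closure Omega `\` interior Omega) x ->
  exists (e : R * R) (gamma : R -> R),
    [/\ dot e e = 1, @Ck R^o 2 gamma &
        \forall y \near x,
          Omega y <-> gamma (dot (- e.2, e.1) y) < dot e y].

Definition C2_domain (Omega : set (R * R)) : Prop :=
  [/\ open Omega, connected Omega, Omega !=set0 & C2_boundary Omega].

End Plane.

Section FunctionSpaces.
Context {R : realType}.
Variable Omega : set (R * R).

Definition integral_Omega (h : R * R -> R) : R := Rintegral mu2 Omega h.

Definition L2 (h : R * R -> R) : Prop :=
  @measurable_fun _ _ (measurableTypeR R * measurableTypeR R)%type
    (measurableTypeR R) Omega h /\
  mu2.-integrable Omega (fun x => ((h x) ^+ 2)%:E).

Definition L2v (v : vfield R) : Prop := L2 (fst \o v) /\ L2 (snd \o v).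

Definition ip (u v : vfield R) : R := integral_Omega (fun x => dot (u x) (v x)).
Definition normL2 (u : vfield R) : R := Num.sqrt (ip u u).

Definition ipg (Du Dv : gfield R) : R :=
  integral_Omega (fun x => dot (Du x).1 (Dv x).1 + dot (Du x).2 (Dv x).2).
Definition normg (Du : gfield R) : R := Num.sqrt (ipg Du Du).

Definition test_function (phi : R * R -> R) : Prop :=
  [/\ forall k, Ck k phi,
      compact (closure [set x | phi x != 0]) &
      closure [set x | phi x != 0] `<=` Omega].

Definition weak_gradient (h : R * R -> R) (Dh : vfield R) : Prop :=
  forall phi, test_function phi ->
    integral_Omega (fun x => h x * (grad phi x).1) = - integral_Omega (fun x => (Dh x).1 * phi x) /\
    integral_Omega (fun x => h x * (grad phi x).2) = - integral_Omega (fun x => (Dh x).2 * phi x).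

(* An element of a Sobolev space is given together with its weak gradient,
   which is unique up to a null set. *)
Definition H1 (h : R * R -> R) (Dh : vfield R) : Prop :=
  [/\ L2 h, L2v Dh & weak_gradient h Dh].

(* H^1_0 is the closure of the test functions in H^1. *)
Definition H10 (h : R * R -> R) (Dh : vfield R) : Prop :=
  H1 h Dh /\
  forall e : R, 0 < e -> exists2 phi, test_function phi &
    integral_Omega (fun x => (phi x - h x) ^+ 2) +
    integral_Omega (fun x => dot (grad phi x - Dh x) (grad phi x - Dh x)) < e.

Definition inV (v : vfield R) (Dv : gfield R) : Prop :=
  [/\ H10 (fst \o v) (fst \o Dv), H10 (snd \o v) (snd \o Dv) &
      {ae mu2, forall x, Omega x -> (Dv x).1.1 + (Dv x).2.2 = 0}].

Definition weakly_div_free (v : vfield R) : Prop :=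
  forall phi, test_function phi -> integral_Omega (fun x => dot (v x) (grad phi x)) = 0.

(* For a square-integrable divergence-free v the normal trace is the functional
   phi |-> (v, grad phi) on H^1, by Green's formula. *)
Definition normal_trace_zero (v : vfield R) : Prop :=
  forall phi Dphi, H1 phi Dphi -> integral_Omega (fun x => dot (v x) (Dphi x)) = 0.

Definition inH (v : vfield R) : Prop :=
  [/\ L2v v, weakly_div_free v & normal_trace_zero v].

(* b(u,v,w) = ((u . grad) v, w), with v given through its gradient. *)
Definition trilinear_b (u : vfield R) (Dv : gfield R) (w : vfield R) : R :=
  integral_Omega (fun x => dot (dot (u x) (Dv x).1, dot (u x) (Dv x).2) (w x)).

Definition stokes_eigenvalue (lambda : R) : Prop :=
  exists v Dv, [/\ inV v Dv, normL2 v != 0 &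
    forall w Dw, inV w Dw -> ipg Dv Dw = lambda * ip v w].

Definition smallest_stokes_eigenvalue (lambda : R) : Prop :=
  stokes_eigenvalue lambda /\
  forall lambda', stokes_eigenvalue lambda' -> lambda <= lambda'.

Definition poincare (lambda : R) : Prop :=
  forall v Dv, inV v Dv -> normL2 v <= (Num.sqrt lambda)^-1 * normg Dv.

Definition simple_H (s : R -> vfield R) : Prop :=
  exists (m : nat) (A : 'I_m -> set (measurableTypeR R)) (h : 'I_m -> vfield R),
    (forall i, measurable (A i) /\ inH (h i)) /\
    forall t, s t = \sum_(i < m) (\1_(A i) t : R) *: (h i : R * R -> R * R).

Definition strongly_measurable (f : R -> vfield R) : Prop :=
  exists s : nat -> R -> vfield R,
    (forall k, simple_H (s k)) /\
    {ae @lebesgue_measure R, forall t, 0 <= t ->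
      (fun k => normL2 (fun x => s k t x - f t x)) @ \oo --> (0 : R)}.

Definition ess_norm (f : R -> vfield R) : \bar R :=
  ess_sup (mrestr (@lebesgue_measure R) (measurable_itv `[(0 : R), +oo[))
    (fun t => (normL2 (f t))%:E).

Definition Linfty_H (f : R -> vfield R) : Prop :=
  [/\ forall t, 0 <= t -> inH (f t),
      strongly_measurable f &
      (ess_norm f < +oo)%E].

Definition norm_infty (f : R -> vfield R) : R := fine (ess_norm f).

End FunctionSpaces.

Section DLN.
Context {R : realType}.

Definition alpha (theta : R) (l : nat) : R :=
  [:: (theta - 1) / 2; - theta; (theta + 1) / 2]`_l.

Definition beta (theta : R) (l : nat) : R :=
  [:: (2 - theta - theta ^+ 2) / 4; theta ^+ 2 / 2;
      (2 + theta - theta ^+ 2) / 4]`_l.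

Definition a_coef (theta : R) (l : nat) : R :=
  let a1 := - Num.sqrt (theta * (1 - theta ^+ 2) / 2) in
  [:: - (a1 / 2); a1; - (a1 / 2)]`_l.

(* sum_(l <= 2) c_l z_(n-1+l), used for n >= 1 only *)
Definition comb (c : nat -> R) (E : lmodType R) (z : nat -> E) (n : nat) : E :=
  \sum_(l < 3) c l *: z (n - 1 + l)%N.

Definition combv (c : nat -> R) (u : nat -> vfield R) (n : nat) : vfield R :=
  comb c (u : nat -> (R * R -> R * R)) n.

Definition combg (c : nat -> R) (Du : nat -> gfield R) (n : nat) : gfield R :=
  comb c (Du : nat -> (R * R -> (R * R) * (R * R))) n.

Definition t_beta (theta dt : R) (n : nat) : R :=
  comb (beta theta) (fun k => k%:R * dt : R^o) n.

Definition dln_scheme (Omega : set (R * R)) (nu theta dt : R)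
    (f : R -> vfield R) (u : nat -> vfield R) (Du : nat -> gfield R) : Prop :=
  (forall n, inV Omega (u n) (Du n)) /\
  forall n, (1 <= n)%N -> forall v Dv, inV Omega v Dv ->
    dt^-1 * ip Omega (combv (alpha theta) u n) v
    + nu * ipg Omega (combg (beta theta) Du n) Dv
    + trilinear_b Omega (combv (beta theta) u n) (combg (beta theta) Du n) v
    = ip Omega (f (t_beta theta dt n)) v.

(* Point values of a class in L^infty(R_+; H) only make sense for a chosen
   representative f; this asks that its samples are at most the essential
   supremum of its norm, as is the case for a suitable choice of f. *)
Definition bounded_samples (Omega : set (R * R)) (theta dt : R)
    (f : R -> vfield R) : Prop :=
  forall n, (1 <= n)%N ->
    normL2 Omega (f (t_beta theta dt n)) <= norm_infty Omega f.

Definition Gnorm2 (Omega : set (R * R)) (theta : R) (u v : vfield R) : R :=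
  (1 + theta) / 4 * normL2 Omega u ^+ 2 + (1 - theta) / 4 * normL2 Omega v ^+ 2.

Definition Hnorm2 (Omega : set (R * R)) (h11 h22 : R) (u v : vfield R) : R :=
  h11 * normL2 Omega u ^+ 2 + h22 * normL2 Omega v ^+ 2.

Definition C_dt (nu lambda1 theta : R) : R :=
  1 / (nu * lambda1) *
  Num.min (8 * theta * (1 - theta ^+ 2)
             / (8 - 6 * theta ^+ 2 + 3 * theta ^+ 4))
          (2 * (1 - theta)).

Definition h11_low (theta : R) : R :=
  theta ^+ 3 / 2 * (1 - 1 / 2 * theta * (1 - theta)).

Definition h22_low (theta : R) : R :=
  1 / 16 * theta * (1 - theta) ^+ 2 * (1 + theta) * (2 + theta).

Definition GH_identity (Omega : set (R * R)) (nu lambda1 theta dt : R)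
    (u : nat -> vfield R) (eps a b c h11 h22 : R) : Prop :=
  forall n, (1 <= n)%N ->
    Gnorm2 Omega theta (u n.+1) (u n) - Gnorm2 Omega theta (u n) (u n.-1)
    + normL2 Omega (combv (a_coef theta) u n) ^+ 2
    + nu * dt * lambda1 / 2 * normL2 Omega (combv (beta theta) u n) ^+ 2
    = (1 + eps) * Hnorm2 Omega h11 h22 (u n.+1) (u n)
      - Hnorm2 Omega h11 h22 (u n) (u n.-1)
      + normL2 Omega (fun x => a *: u n.+1 x + b *: u n x + c *: u n.-1 x) ^+ 2.

Definition Chat_h (Ch theta : R) : R := Ch / h11_low theta.

Definition rho0 (Ceps nu lambda1 theta finf : R) : R :=
  Ceps / (nu ^+ 2 * lambda1 ^+ 2 * theta ^+ 3
            * (1 - 1 / 2 * theta * (1 - theta))) * finf ^+ 2.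

(* Extended-real valued, so that ln 0 = -oo when u_0 = u_1 = 0, and the
   threshold is +oo when rho_0 = 0 and (u_0, u_1) is not zero. *)
Definition Tstar (Ch Ceps nu lambda1 theta nu0 nu1 finf : R) : \bar R :=
  ((4 * Ceps / (nu * lambda1))%:E *
   lne ((Chat_h Ch theta * (nu1 ^+ 2 + nu0 ^+ 2))%:E
          / (rho0 Ceps nu lambda1 theta finf)%:E))%E.

End DLN.

(* Main.v *)
Require Import Defs.
From HB Require Import structures.
From mathcomp Require Import all_boot all_order all_algebra.
From mathcomp Require Import all_classical all_reals all_analysis.
From mathcomp Require Import measurable_realfun ring lra.
Import Order.TTheory GRing.Theory Num.Theory.
Import numFieldNormedType.Exports.
Local Open Scope classical_set_scope.
Local Open Scope ring_scope.

(** The proof is an energy estimate followed by a discrete Gronwall argument.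

    Testing the scheme with w = u_{n,beta} removes the nonlinearity, because
    b(w, w, w) = 0 ([trilinear_b_self_eq0]), and turns the difference quotient
    into a difference of G-norms plus a square ([G_identity]).  Young's
    inequality absorbs half of the viscous term, which the Poincare inequality
    bounds below by nu lambda_1 |w|^2; what is left of it is exactly the term
    (nu dt lambda_1 / 2) |w|^2 of the identity relating the G- and H-norms.
    That identity therefore gives a contraction ([energy_step]):

      (1 + eps) H_{n+1} <= H_n + dt / (2 nu lambda_1) |f|_oo^2,

    where H_n is the H-norm squared of the pair (u_{n+1}, u_n).  Iterating
    ([discrete_gronwall]) bounds H_n by (1 + eps)^-n H_0 plus
    dt |f|_oo^2 / (2 nu lambda_1 eps).  Dividing by the lower bound of h11, the
    second part is at most rho_0 since 1/eps < C_eps / (nu lambda_1 dt).  The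
    first part is at most rho_0 once n dt exceeds T_*, because
    exp (eps / 4) <= 1 + eps for eps < 4 ([expR_quarter_le]), so that the factor
    (1 + eps)^-n beats the exponential rate hidden in T_*.  When N = 0 the
    hypothesis forces T_* to be negative and the initial data are already below
    rho_0.

    The analytic work is in b(v, v, v) = 0 for v in V, a space defined only
    through weak gradients and approximation by test functions.  Formally
    (v . grad v) . v = v . grad (|v|^2 / 2) integrates to zero since div v = 0.
    To make this rigorous without a Sobolev embedding, |v|^2 is replaced by the
    bounded function |v|^2 / (1 + eps |v|^2), with a new parameter eps > 0.  Its
    gradient carries the damping factor (1 + eps |v|^2)^-2, which makes the
    coefficient of grad v bounded.
    For test functions phi in place of v the damped energy is a test function,
    so the identity is the weak form of div v = 0; it passes to the limit
    phi -> v because rapid convergence in L^2 yields convergence almost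
    everywhere together with an L^2 majorant ([square_integrable_fast_dominated]).
    Finally eps tends to 0 by dominated convergence. *)

(** * Square-integrable functions *)

Section SquareIntegrable.
Context d (T : measurableType d) (R : realType).
Variables (mu : {measure set T -> \bar R}) (D : set T).
Hypothesis mD : measurable D.
Implicit Types f g h p w : T -> R.

Definition square_integrable h :=
  measurable_fun D h /\ mu.-integrable D (fun x => ((h x) ^+ 2)%:E).

Lemma integrable_dominated f g : measurable_fun D f ->
  (forall x, D x -> `|f x| <= g x) ->
  mu.-integrable D (EFin \o g) -> mu.-integrable D (EFin \o f).
Proof.
move=> mf fg ig; apply: (le_integrable mD) ig.
  exact/measurable_EFinP.
by move=> x Dx /=; rewrite lee_fin (le_trans (fg _ Dx))// ler_norm.
Qed.

Lemma integrable_lin (a b : R) f g :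
  mu.-integrable D (EFin \o f) -> mu.-integrable D (EFin \o g) ->
  mu.-integrable D (EFin \o (fun x => a * f x + b * g x)).
Proof.
move=> fi gi.
rewrite (_ : _ \o _ = (fun x => a%:E * (EFin \o f) x)%E \+
                      (fun x => b%:E * (EFin \o g) x)%E)//.
by apply: integrableD => //; exact: integrableZl.
Qed.

Lemma Rintegral_lin (a b : R) f g :
  mu.-integrable D (EFin \o f) -> mu.-integrable D (EFin \o g) ->
  Rintegral mu D (fun x => a * f x + b * g x) =
  a * Rintegral mu D f + b * Rintegral mu D g.
Proof.
move=> fi gi; rewrite RintegralD//; first by rewrite !RintegralZl.
  exact: integrableZl fi.
exact: integrableZl gi.
Qed.

Lemma square_integrableM f g : square_integrable f -> square_integrable g ->
  mu.-integrable D (EFin \o (fun x => f x * g x)).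
Proof.
move=> [mf fi] [mg gi].
apply: (@integrable_dominated _ (fun x => 2^-1 * f x ^+ 2 + 2^-1 * g x ^+ 2)).
- exact: measurable_funM.
- move=> x _; rewrite ler_norml; apply/andP; split.
    by have := sqr_ge0 (f x + g x); nra.
  by have := sqr_ge0 (f x - g x); nra.
- exact: integrable_lin.
Qed.

Lemma square_integrable_lin (a b : R) f g : square_integrable f -> square_integrable g ->
  square_integrable (fun x => a * f x + b * g x).
Proof.
move=> fi gi; have [mf f2i] := fi; have [mg g2i] := gi.
have m1 : measurable_fun D (fun x => a * f x + b * g x).
  by apply: measurable_funD; apply: measurable_funM => //; exact: measurable_cst.
split => //.
have -> : (fun x => ((a * f x + b * g x) ^+ 2)%:E) = EFin \o
    (fun x => a ^+ 2 * f x ^+ 2 +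
       1 * (2 * a * b * (f x * g x) + b ^+ 2 * g x ^+ 2)).
  by apply/funext => x /=; congr EFin; ring.
apply: integrable_lin => //; apply: integrable_lin => //; exact: square_integrableM.
Qed.

(** Integrated form of s (f - g / s)^2 >= 0. *)
Lemma Rintegral_young (s : R) f g : 0 < s -> square_integrable f -> square_integrable g ->
  2 * Rintegral mu D (fun x => f x * g x) <=
  s * Rintegral mu D (fun x => f x ^+ 2) +
  s^-1 * Rintegral mu D (fun x => g x ^+ 2).
Proof.
move=> s0 fi gi; have := square_integrableM _ _ fi gi; case: fi gi => [mf fi] [mg gi] fgi.
rewrite -Rintegral_lin// -RintegralZl//; apply: le_Rintegral => //.
- exact: integrableZl fgi.
- exact: integrable_lin.
- move=> x _; rewrite -subr_ge0.
  have -> : s * f x ^+ 2 + s^-1 * g x ^+ 2 - 2 * (f x * g x) =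
    s * (f x - s^-1 * g x) ^+ 2 by field; rewrite gt_eqF.
  by rewrite mulr_ge0 ?sqr_ge0 ?ltW.
Qed.

Lemma Rintegral_dominated_cvg (h_ : nat -> T -> R) h g :
  (forall n, measurable_fun D (h_ n)) -> measurable_fun D h ->
  {ae mu, forall x, D x -> h_ ^~ x @ \oo --> h x} ->
  mu.-integrable D (EFin \o g) ->
  {ae mu, forall x n, D x -> `|h_ n x| <= g x} ->
  mu.-integrable D (EFin \o h) /\
  (fun n => Rintegral mu D (h_ n)) @ \oo --> Rintegral mu D h.
Proof.
move=> mh_ mh cvh gi hg.
have [] := @dominated_convergence _ T R mu D mD (fun n => EFin \o h_ n)
  (EFin \o h) (EFin \o g).
- by move=> n; exact/measurable_EFinP.
- exact/measurable_EFinP.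
- by apply: filterS cvh => x H Dx /=; apply: cvg_EFin => //; [exact: nearW|exact: H].
- exact: gi.
- by apply: filterS hg => x H n Dx /=; rewrite lee_fin H.
move=> hi _ cv; split => //; apply: fine_cvg.
rewrite fineK; first exact: cv.
exact: integrable_fin_num.
Qed.

Lemma Rintegral_ae_eq f g : measurable_fun D f -> measurable_fun D g ->
  {ae mu, forall x, D x -> f x = g x} -> Rintegral mu D f = Rintegral mu D g.
Proof.
move=> mf mg fg; congr fine; apply: ae_eq_integral => //.
- exact/measurable_EFinP.
- exact/measurable_EFinP.
- by apply: filterS fg => x H Dx /=; rewrite H.
Qed.

(** The errors e_n are small enough for the series of their squared norms to
    converge.  By monotone convergence the series of the e_n^2 has an integrable
    sum S; it bounds every e_n^2, and where it is finite its terms tend to 0. *)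
Lemma square_integrable_fast_dominated (e : nat -> T -> R) :
  (forall n, square_integrable (e n)) ->
  (forall n, Rintegral mu D (fun x => e n x ^+ 2) <= 1 / (2 ^ n.+1)%:R) ->
  exists S : T -> R, mu.-integrable D (EFin \o S) /\
    {ae mu, forall x, D x ->
       (forall n, e n x ^+ 2 <= S x) /\ e ^~ x @ \oo --> (0 : R)}.
Proof.
move=> ei e2.
pose F x : \bar R := (\sum_(n <oo) (e n x ^+ 2)%:E)%E.
have e0 n x : (0 <= (e n x ^+ 2)%:E)%E by rewrite lee_fin sqr_ge0.
have me n : measurable_fun D (fun x => (e n x ^+ 2)%:E).
  by have [_ /integrableP[]] := ei n.
have F0 x : (0 <= F x)%E by apply: nneseries_ge0 => n _ _.
have mF : measurable_fun D F.
  by apply: ge0_emeasurable_sum => //.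
have iF : mu.-integrable D F.
  apply/integrableP; split => //.
  under eq_integral do rewrite gee0_abs//.
  rewrite integral_nneseries//.
  apply: (@le_lt_trans _ _ (\sum_(n <oo) (1 / (2 ^ n.+1)%:R)%:E)%E).
    apply: lee_nneseries => [n _ _|n _]; first exact: integral_ge0.
    have [_ e2i] := ei n.
    by rewrite -(fineK (integrable_fin_num mD e2i)) lee_fin; exact: e2.
  by apply: le_lt_trans (epsilon_trick0 _ _) _; rewrite ?ltry.
exists (fine \o F); split.
  apply: (le_integrable mD) iF.
    by apply/measurable_EFinP; apply: measurableT_comp => //; exact: fine_measurable.
  move=> x Dx /=; case: (F x) (F0 x) => [r| |]//= _; rewrite normr0; exact: leey.
apply: filterS (integrable_ae mD iF) => x H Dx; have Ff := H Dx.
split.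
  move=> n; rewrite -lee_fin /= fineK//.
  apply: le_trans (nneseries_lim_ge n.+1 _) => //.
  rewrite big_mkord big_ord_recr/= leeDr//; exact: sume_ge0.
have tl := @nneseries_tail_cvg _ (fun n => (e n x ^+ 2)%:E) xpredT.
have {}tl := tl _ (fun n _ => e0 n x).
have Fy : (F x < +oo)%E by rewrite -ge0_fin_numE.
have cv2 : (fun n => (e n x ^+ 2)%:E) @ \oo --> 0%E.
  apply: squeeze_cvge (tl Fy); last exact: cvg_cst.
  apply: nearW => n; rewrite e0/=.
  apply: le_trans (nneseries_lim_ge n.+1 _) => //.
  by rewrite big_nat1.
have {}cv2 : (fun n => e n x ^+ 2) @ \oo --> (0 : R).
  exact: (fine_cvg (cv2 : _ --> (0 : R)%:E)).
apply/norm_cvg0P.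
have := cvg_comp _ _ cv2 (@sqrt_continuous R 0).
rewrite sqrtr0; apply: cvg_trans; apply: near_eq_cvg; apply: nearW => n /=.
by rewrite sqrtr_sqr.
Qed.

(** Limit of a product of a bounded factor converging almost everywhere, a fixed
    square-integrable factor and one converging in L^2.  With S the majorant of
    the (g_n - g)^2, the integrands are bounded by B (|w g| + w^2 + S), so that
    dominated convergence applies. *)
Lemma Rintegral_cvg_bounded_square_integrable (B : R) (p_ g_ : nat -> T -> R) p w g :
  (forall n, measurable_fun D (p_ n)) -> measurable_fun D p ->
  (forall n x, `|p_ n x| <= B) ->
  {ae mu, forall x, D x -> p_ ^~ x @ \oo --> p x} ->
  square_integrable w -> square_integrable g -> (forall n, square_integrable (g_ n)) ->
  (forall n, Rintegral mu D (fun x => (g_ n x - g x) ^+ 2) <= 1 / (2 ^ n.+1)%:R) ->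
  mu.-integrable D (EFin \o (fun x => p x * (w x * g x))) /\
  (fun n => Rintegral mu D (fun x => p_ n x * (w x * g_ n x))) @ \oo -->
  Rintegral mu D (fun x => p x * (w x * g x)).
Proof.
move=> mp_ mp pB cvp wi gi gi_ gg.
have ei n : square_integrable (fun x => g_ n x - g x).
  rewrite (_ : (fun x => _) = (fun x => 1 * g_ n x + (-1) * g x)).
    exact: square_integrable_lin.
  by apply/funext => x; ring.
have [S [Si SS]] := square_integrable_fast_dominated _ ei gg.
have wgi := square_integrableM _ _ wi gi.
have [mw w2i] := wi; have [mg g2i] := gi.
have B0 : 0 <= B by apply: le_trans (pB 0%N point).
apply: (@Rintegral_dominated_cvg _ _
  (fun x => B * `|w x * g x| + B * (1 * w x ^+ 2 + 1 * S x))).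
- move=> n; have [mgn _] := gi_ n.
  by apply: measurable_funM => //; exact: measurable_funM.
- by apply: measurable_funM => //; exact: measurable_funM.
- apply: filterS2 cvp SS => x H1 H2 Dx; have [_ c0] := H2 Dx.
  apply: cvgM; first exact: H1.
  apply: cvgM; first exact: cvg_cst.
  by apply/subr_cvg0.
- apply: integrable_lin; last exact: integrable_lin.
  exact: (integrable_norm wgi).
- apply: filterS SS => x H n Dx; have [H2 _] := H Dx.
  rewrite normrM -mulrDr ler_pM// !mul1r.
  have -> : w x * g_ n x = w x * g x + w x * (g_ n x - g x) by ring.
  rewrite (le_trans (ler_normD _ _))// lerD2l.
  apply: (@le_trans _ _ (w x ^+ 2 + (g_ n x - g x) ^+ 2)); last by rewrite lerD2l.
  move: (w x) (g_ n x - g x) => {H H2} a b; rewrite ler_norml; apply/andP; split; nra.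
Qed.

End SquareIntegrable.

Arguments square_integrable {d T R} mu D h.
Arguments integrable_lin {d T R mu D} mD a b {f g}.
Arguments Rintegral_lin {d T R mu D} mD a b {f g}.
Arguments square_integrableM {d T R mu D} mD {f g}.
Arguments square_integrable_lin {d T R mu D} mD a b {f g}.
Arguments Rintegral_young {d T R mu D} mD {s f g}.
Arguments Rintegral_dominated_cvg {d T R mu D} mD h_ h g.
Arguments Rintegral_ae_eq {d T R mu D} mD {f g}.
Arguments Rintegral_cvg_bounded_square_integrable {d T R mu D} mD B p_ g_ p w g.

(** * Test functions on the plane *)

Section CkAlgebra.
Context (R : realType) (V : normedModType R).
Implicit Types f g : V -> R.

Lemma Ck_diff k f : Ck k.+1 f -> forall x, differentiable f x.
Proof. by case. Qed.

Lemma Ck_derive k f v : Ck k.+1 f -> Ck k ('D_v f).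
Proof. by case=> _; exact. Qed.

Lemma CkS k f : Ck k.+1 f -> Ck k f.
Proof.
elim: k f => [|k IH] f [df Df].
  by move=> x; exact: differentiable_continuous.
by split=> // v; exact: IH.
Qed.

Lemma Ck_cst k (c : R) : Ck k (fun _ : V => c).
Proof.
elim: k c => [|k IH] c; first by move=> x; exact: cvg_cst.
split; first by move=> x; exact: differentiable_cst.
move=> v; have -> : 'D_v (fun _ : V => c) = (fun _ : V => 0 : R) by
  apply/funext => x; exact: derive_cst.
exact: IH.
Qed.

Lemma CkD k f g : Ck k f -> Ck k g -> Ck k (fun x => f x + g x).
Proof.
elim: k f g => [|k IH] f g cf cg.
  by move=> x; apply: cvgD; [exact: cf|exact: cg].
have df := Ck_diff _ _ cf; have dg := Ck_diff _ _ cg.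
split; first by move=> x; exact: differentiableD.
move=> v; have -> : 'D_v (fun x => f x + g x) = fun x => 'D_v f x + 'D_v g x.
  by apply/funext => x; apply: deriveD; exact: diff_derivable.
by apply: IH; exact: Ck_derive.
Qed.

Lemma derive_mul f g v x : differentiable f x -> differentiable g x ->
  'D_v (fun x => f x * g x) x = f x * 'D_v g x + g x * 'D_v f x.
Proof. by move=> df dg; apply: deriveM; exact: diff_derivable. Qed.

Lemma CkM k f g : Ck k f -> Ck k g -> Ck k (fun x => f x * g x).
Proof.
elim: k f g => [|k IH] f g cf cg.
  by move=> x; apply: cvgM; [exact: cf|exact: cg].
have df := Ck_diff _ _ cf; have dg := Ck_diff _ _ cg.
split; first by move=> x; exact: differentiableM.
move=> v; have -> : 'D_v (fun x => f x * g x) =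
    fun x => f x * 'D_v g x + g x * 'D_v f x.
  by apply/funext => x; exact: derive_mul.
by apply: CkD; apply: IH; (exact: Ck_derive || exact: CkS).
Qed.

(** The derivative of 1/f is - (1/f)^2 f', so that one more order of
    differentiability of 1/f follows from the previous order by products. *)
Lemma CkV k f : (forall x, f x != 0) -> Ck k f -> Ck k (fun x => (f x)^-1).
Proof.
move=> f0; elim: k => [|k IH] cf.
  by move=> x; apply: cvgV => //; exact: cf.
have df := Ck_diff _ _ cf.
split; first by move=> x; exact: differentiableV.
move=> v; have -> : 'D_v (fun x => (f x)^-1) =
    fun x => -1 * ((f x)^-1 * (f x)^-1 * 'D_v f x).
  apply/funext => x; rewrite deriveV//; last exact: diff_derivable.
  by rewrite mulrA mulN1r -invfM -expr2.
apply: CkM; first exact: Ck_cst.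
apply: CkM; last exact: Ck_derive.
by apply: CkM; apply: IH; exact: CkS.
Qed.

End CkAlgebra.

Section PlaneMeasure.
Context (R : realType).
Local Notation plane := (measurableTypeR R * measurableTypeR R)%type.

(** An open set is a countable union of products of balls with rational centres
    and a common rational radius, and these products generate the product
    sigma-algebra. *)
Lemma open_plane_measurable (U : set (R * R)) : open U ->
  @measurable _ plane U.
Proof.
move=> oU.
pose box (q : rat * rat * rat) : set (R * R) :=
  ball (ratr q.1.1 : R) (ratr q.2 : R) `*` ball (ratr q.1.2 : R) (ratr q.2 : R).
pose F q : set (R * R) := if `[< box q `<=` U >] then box q else set0.
rewrite (_ : U = \bigcup_q F q); last first.
  apply/seteqP; split => [x Ux|x [q _]]; last first.
    by rewrite /F; case: asboolP => // qU; exact: qU.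
  have /nbhs_ballP[e /= e0 xeU] : nbhs x U by exact: open_nbhs_nbhs.
  have [r /andP[r0 re]] : exists r : rat, 0 < (ratr r : R) < e / 2.
    have /rat_in_itvoo[r] : 0 < e / 2 by rewrite divr_gt0.
    by rewrite in_itv/= => ?; exists r.
  have near_rat (y : R) : exists c : rat, ball (ratr c : R) (ratr r : R) y.
    have /rat_in_itvoo[c] : y - ratr r < y + ratr r by lra.
    rewrite in_itv/= => /andP[c1 c2]; exists c.
    by rewrite /ball/= ltr_norml; apply/andP; split; lra.
  have [c1 H1] := near_rat x.1; have [c2 H2] := near_rat x.2.
  have sub : box (c1, c2, r) `<=` U.
    have tri (y z : R) c : ball (ratr c : R) (ratr r : R) y ->
        ball (ratr c : R) (ratr r : R) z -> ball y e z.
      rewrite /ball/= => A B.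
      have -> : y - z = (ratr c - z) - (ratr c - y) by ring.
      by apply: le_lt_trans (ler_normB _ _) _; lra.
    move=> y [/= y1 y2]; apply: xeU; split; first exact: (tri _ _ c1).
    exact: (tri _ _ c2).
  by exists (c1, c2, r); rewrite ?/F; [|case: asboolP => [_|]].
apply: (@countable_bigcupT_measurable _ plane _ F); first exact: countableP.
move=> q; rewrite /F; case: asboolP => _; last exact: measurable0.
by apply: measurableX; exact: measurable_ball.
Qed.

Lemma continuous_plane_measurable (g : R * R -> R) : continuous g ->
  @measurable_fun _ _ plane (measurableTypeR R) setT g.
Proof.
move=> /continuousP cg; apply: (measurability _ (RGenOpens.measurableE R)).
move=> _ [_ [a [b ->] <-]]; rewrite setTI; apply: open_plane_measurable.
exact/cg/interval_open.
Qed.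

Lemma mu2_compact_lty (K : set (R * R)) : compact K -> closed K ->
  (mu2 K < +oo)%E.
Proof.
move=> cK clK; have [M [_ MK]] := compact_bounded cK.
have {}MK : forall x, K x -> `|x| <= M + 1 by apply: MK; rewrite ltrDl.
pose I : set (measurableTypeR R) := `[- (M + 1), M + 1]%classic.
have mI : measurable I by exact: measurable_itv.
have KI : K `<=` I `*` I.
  move=> x /MK; rewrite prod_normE ge_max => /andP[x1 x2].
  by split; rewrite /I/= in_itv/= -ler_norml.
have mK : @measurable _ plane K.
  by rewrite -(setCK K); apply: measurableC; apply: open_plane_measurable;
    exact: closed_openC.
apply: (@le_lt_trans _ _ (mu2 (I `*` I))).
  by apply: le_measure => //; rewrite inE//; exact: measurableX.
have Ioo : (@lebesgue_measure R I < +oo)%E.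
  by rewrite /I lebesgue_measure_itv/=; case: ifP; rewrite ?ltry.
have -> : mu2 (I `*` I) = (@lebesgue_measure R I * @lebesgue_measure R I)%E.
  exact: product_measure1E.
by apply: lte_mul_pinfty => //; rewrite ge0_fin_numE.
Qed.

(** The square is bounded on the support, which is compact and so has finite
    measure, and vanishes outside of it. *)
Lemma L2_continuous_compact (Omega : set (R * R)) (g : R * R -> R) :
  @measurable _ plane Omega -> continuous g ->
  compact (closure [set x | g x != 0]) -> L2 Omega g.
Proof.
move=> mO cg cK; set K := closure _ in cK.
have mg := continuous_plane_measurable _ cg.
have mgO : @measurable_fun _ _ plane (measurableTypeR R) Omega g.
  exact: measurable_funS mg.
split=> //.
have clK : closed K by exact: closed_closure.
have mK : @measurable _ plane K.
  by rewrite -(setCK K); apply: measurableC; apply: open_plane_measurable;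
    exact: closed_openC.
have mg2 : @measurable_fun _ _ plane (measurableTypeR R) setT
    (fun x => g x ^+ 2) by exact: measurable_funX.
have g2K : mu2.-integrable K (EFin \o (fun x => g x ^+ 2)).
  apply: measurable_bounded_integrable => //.
  - exact: mu2_compact_lty.
  - exact: measurable_funS mg2.
  - have : compact ((fun x => g x ^+ 2) @` K).
      apply: continuous_compact => //; apply: continuous_subspaceT => x.
      by apply: cvgM; exact: cg.
    move=> /compact_bounded [M [Mr HM]]; exists M; split=> // N MN x Kx.
    by apply: (HM N MN); exists x.
have g2T : mu2.-integrable setT (EFin \o (fun x => g x ^+ 2)).
  apply/integrableP; split.
    by apply/measurable_EFinP.
  have /integrableP[_] := g2K; apply: le_lt_trans.
  rewrite integral_mkcond [leRHS]integral_mkcond.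
  apply: ge0_le_integral => //.
  - by move=> x _; rewrite patch_setT.
  - rewrite patch_setT; apply: measurableT_comp => //; exact/measurable_EFinP.
  - apply/(measurable_restrictT _ mK); apply: measurableT_comp => //.
    by apply/measurable_EFinP; exact: measurable_funS mg2.
  - move=> x _; rewrite patch_setT patchE /=; case: ifPn => // xK.
    rewrite notin_setE in xK.
    have -> : g x = 0.
      by apply: contrapT => gx; apply: xK; apply: subset_closure; exact/eqP.
    by rewrite expr0n/= normr0.
exact: integrableS g2T.
Qed.

Lemma test_function_support (Omega : set (R * R)) (phi1 phi2 psi : R * R -> R) :
  test_function Omega phi1 -> test_function Omega phi2 ->
  (forall k, Ck k psi) ->
  (forall x, phi1 x = 0 -> phi2 x = 0 -> psi x = 0) ->
  test_function Omega psi.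
Proof.
move=> [_ c1 s1] [_ c2 s2] cpsi psi0.
have sub : closure [set x | psi x != 0] `<=`
    closure [set x | phi1 x != 0] `|` closure [set x | phi2 x != 0].
  rewrite -closureU; apply: closureS => x /= px.
  have [p1|p1] := eqVneq (phi1 x) 0; last by left.
  have [p2|p2] := eqVneq (phi2 x) 0; last by right.
  by move: px; rewrite psi0// eqxx.
split=> //.
  apply: subclosed_compact sub; first exact: closed_closure.
  exact: compactU.
by move=> x /sub [/s1|/s2].
Qed.

(** Off the closed support of phi the function vanishes on a neighbourhood, hence
    so do its derivatives: supports do not grow under differentiation. *)
Lemma test_function_derive (Omega : set (R * R)) (phi : R * R -> R) v :
  test_function Omega phi -> test_function Omega ('D_v phi).
Proof.
move=> [ck cK sO].
have sub : closure [set x | 'D_v phi x != 0] `<=` closure [set x | phi x != 0].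
  set K := closure [set x | phi x != 0].
  have clK : closed K by exact: closed_closure.
  rewrite [X in _ `<=` X](closure_id K).1//; apply: closureS => x /= Dx.
  apply: contrapT => Kx; move/eqP: Dx; apply.
  rewrite -(derive_cst (0 : R) x v); apply: near_eq_derive.
  have : nbhs x (~` K) by apply: open_nbhs_nbhs; split => //; exact: closed_openC.
  apply: filterS => y Ky; apply: contrapT => /eqP phiy; apply: Ky.
  exact: subset_closure.
split; first by move=> k; exact: Ck_derive.
- by apply: subclosed_compact sub => //; exact: closed_closure.
- by move=> x /sub; exact: sO.
Qed.

Lemma test_function_lin (Omega : set (R * R)) (a b : R) (phi psi : R * R -> R) :
  test_function Omega phi -> test_function Omega psi ->
  test_function Omega (fun x => a * phi x + b * psi x).
Proof.
move=> tphi tpsi; have [cphi _ _] := tphi; have [cpsi _ _] := tpsi.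
apply: (test_function_support _ _ _ _ tphi tpsi) => [k|x -> ->];
  last by rewrite !mulr0 addr0.
by apply: CkD; apply: CkM => //; exact: Ck_cst.
Qed.

Lemma test_function_L2 (Omega : set (R * R)) (phi : R * R -> R) : open Omega ->
  test_function Omega phi -> L2 Omega phi.
Proof.
move=> oO [ck cK _]; apply: L2_continuous_compact => //; last exact: (ck 0%N).
exact: open_plane_measurable.
Qed.

Lemma test_function_grad_L2 (Omega : set (R * R)) (phi : R * R -> R) :
  open Omega -> test_function Omega phi -> L2v Omega (grad phi).
Proof.
by move=> oO tphi; split; apply: test_function_L2 => //;
  exact: test_function_derive.
Qed.

End PlaneMeasure.

Arguments test_function_support {R Omega phi1 phi2} psi.

(** * Linearity of the spaces *)

#[local] Instance mu2_ae_filter (R : realType) :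
  Filter (nbhs (almost_everywhere (@mu2 R))).
Proof. exact: (@ae_filter_ringOfSetsType _ _ R mu2). Qed.

Section SobolevLinear.
Context (R : realType).
Local Notation plane := (measurableTypeR R * measurableTypeR R)%type.
Variables (Omega : set (R * R)).
Hypothesis oO : open Omega.

Let mO : @measurable _ plane Omega.
Proof. exact: open_plane_measurable. Qed.

Local Notation integrableO h := (@integrable _ plane R mu2 Omega (EFin \o h)).

Lemma L2_lin (a b : R) (h g : R * R -> R) : L2 Omega h -> L2 Omega g ->
  L2 Omega (fun x => a * h x + b * g x).
Proof. exact: (square_integrable_lin mO). Qed.

Lemma L2M (h g : R * R -> R) : L2 Omega h -> L2 Omega g ->
  integrableO (fun x => h x * g x).
Proof. exact: (square_integrableM mO). Qed.

Lemma L2v_lin (a b : R) (v w : vfield R) : L2v Omega v -> L2v Omega w ->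
  L2v Omega (fun x => a *: v x + b *: w x).
Proof. by move=> [v1 v2] [w1 w2]; split; exact: L2_lin. Qed.

Lemma L2v_dot (v w : vfield R) : L2v Omega v -> L2v Omega w ->
  integrableO (fun x => dot (v x) (w x)).
Proof.
move=> [v1 v2] [w1 w2].
have := integrable_lin mO 1 1 (L2M _ _ v1 w1) (L2M _ _ v2 w2).
by congr (integrable _ _ _); apply/funext => x /=; rewrite !mul1r.
Qed.

Lemma integral_lin (a b : R) (h g : R * R -> R) :
  integrableO h -> integrableO g ->
  integral_Omega Omega (fun x => a * h x + b * g x) =
  a * integral_Omega Omega h + b * integral_Omega Omega g.
Proof. exact: (Rintegral_lin mO). Qed.

Lemma integral_le (h g : R * R -> R) : integrableO h -> integrableO g ->
  (forall x, Omega x -> h x <= g x) ->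
  integral_Omega Omega h <= integral_Omega Omega g.
Proof. exact: (le_Rintegral mO). Qed.

Lemma weak_gradient_lin (a b : R) (h g : R * R -> R) (Dh Dg : vfield R) :
  H1 Omega h Dh -> H1 Omega g Dg ->
  weak_gradient Omega (fun x => a * h x + b * g x)
    (fun x => a *: Dh x + b *: Dg x).
Proof.
move=> [h2 [Dh1 Dh2] wh] [g2 [Dg1 Dg2] wg] phi tphi.
have [wh1 wh2] := wh _ tphi; have [wg1 wg2] := wg _ tphi.
have p2 := test_function_L2 _ _ _ oO tphi.
have [q1 q2] := test_function_grad_L2 _ _ _ oO tphi.
have lin (h' g' q : R * R -> R) :
    L2 Omega h' -> L2 Omega g' -> L2 Omega q ->
    integral_Omega Omega (fun x => (a * h' x + b * g' x) * q x) =
    a * integral_Omega Omega (fun x => h' x * q x) +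
    b * integral_Omega Omega (fun x => g' x * q x).
  move=> ? ? ?; rewrite -integral_lin; [|exact: L2M|exact: L2M].
  by congr (integral_Omega _ _); apply/funext => x; ring.
split.
  rewrite (lin h g (fst \o grad phi))// wh1 wg1.
  by rewrite (lin (fst \o Dh) (fst \o Dg))//=; ring.
rewrite (lin h g (snd \o grad phi))// wh2 wg2.
by rewrite (lin (snd \o Dh) (snd \o Dg))//=; ring.
Qed.

Lemma H1_lin (a b : R) (h g : R * R -> R) (Dh Dg : vfield R) :
  H1 Omega h Dh -> H1 Omega g Dg ->
  H1 Omega (fun x => a * h x + b * g x) (fun x => a *: Dh x + b *: Dg x).
Proof.
move=> hH gH; have [h2 Dh2 _] := hH; have [g2 Dg2 _] := gH.
by split; [exact: L2_lin|exact: L2v_lin|exact: weak_gradient_lin].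
Qed.

Lemma L2_sub (h g : R * R -> R) : L2 Omega h -> L2 Omega g ->
  L2 Omega (fun x => h x - g x).
Proof.
move=> h2 g2; have := L2_lin 1 (-1) _ _ h2 g2.
by congr (L2 _ _); apply/funext => x; ring.
Qed.

Lemma L2v_sub (v w : vfield R) : L2v Omega v -> L2v Omega w ->
  L2v Omega (fun x => v x - w x).
Proof. by move=> [v1 v2] [w1 w2]; split; exact: L2_sub. Qed.

(** Integrated form of (p + q)^2 <= 2 p^2 + 2 q^2. *)
Lemma integral_sqr_lin_le (a b : R) (h g : R * R -> R) :
  L2 Omega h -> L2 Omega g ->
  integral_Omega Omega (fun x => (a * h x + b * g x) ^+ 2) <=
  2 * a ^+ 2 * integral_Omega Omega (fun x => h x ^+ 2) +
  2 * b ^+ 2 * integral_Omega Omega (fun x => g x ^+ 2).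
Proof.
move=> h2 g2; have [_ lin2] := L2_lin a b _ _ h2 g2.
rewrite -integral_lin; [|exact: h2.2|exact: g2.2].
apply: integral_le => //.
  by apply: integrable_lin => //; [exact: h2.2|exact: g2.2].
move=> x _; rewrite -subr_ge0.
have -> : 2 * a ^+ 2 * h x ^+ 2 + 2 * b ^+ 2 * g x ^+ 2 -
  (a * h x + b * g x) ^+ 2 = (a * h x - b * g x) ^+ 2 by ring.
exact: sqr_ge0.
Qed.

Lemma integral_dot (v w : vfield R) : L2v Omega v -> L2v Omega w ->
  integral_Omega Omega (fun x => dot (v x) (w x)) =
  integral_Omega Omega (fun x => (v x).1 * (w x).1) +
  integral_Omega Omega (fun x => (v x).2 * (w x).2).
Proof.
move=> [v1 v2] [w1 w2].
by apply: (RintegralD mO); [exact: (L2M _ _ v1 w1)|exact: (L2M _ _ v2 w2)].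
Qed.

Lemma H10_lin (a b : R) (h g : R * R -> R) (Dh Dg : vfield R) :
  H10 Omega h Dh -> H10 Omega g Dg ->
  H10 Omega (fun x => a * h x + b * g x) (fun x => a *: Dh x + b *: Dg x).
Proof.
move=> [hH ha] [gH ga]; split; first exact: H1_lin.
move=> e e0; pose C := 2 * a ^+ 2 + 2 * b ^+ 2 + 1.
have C0 : 0 < C by rewrite /C; have := sqr_ge0 a; have := sqr_ge0 b; lra.
have [phi tphi ephi] := ha (e / C) (divr_gt0 e0 C0).
have [psi tpsi epsi] := ga (e / C) (divr_gt0 e0 C0).
exists (fun x => a * phi x + b * psi x); first exact: test_function_lin.
have [h2 Dh2 _] := hH; have [g2 Dg2 _] := gH.
have p2 := test_function_L2 _ _ _ oO tphi.
have q2 := test_function_L2 _ _ _ oO tpsi.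
have gp2 := test_function_grad_L2 _ _ _ oO tphi.
have gq2 := test_function_grad_L2 _ _ _ oO tpsi.
have dl v x : 'D_v (fun x => a * phi x + b * psi x) x =
    a * 'D_v phi x + b * 'D_v psi x.
  have [/(_ 1%N) /Ck_diff dphi _ _] := tphi.
  have [/(_ 1%N) /Ck_diff dpsi _ _] := tpsi.
  rewrite [LHS](@deriveD _ _ _ (fun x => a * phi x) (fun x => b * psi x)).
  - by rewrite !deriveZ//; exact: diff_derivable.
  - by apply: derivableZ; exact: diff_derivable.
  - by apply: derivableZ; exact: diff_derivable.
have I1 := integral_sqr_lin_le a b _ _ (L2_sub _ _ p2 h2) (L2_sub _ _ q2 g2).
have [dp1 dp2] := L2v_sub _ _ gp2 Dh2; have [dq1 dq2] := L2v_sub _ _ gq2 Dg2.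
have I2 := integral_sqr_lin_le a b _ _ dp1 dq1.
have I3 := integral_sqr_lin_le a b _ _ dp2 dq2.
have dot2 (v : vfield R) : L2v Omega v ->
    integral_Omega Omega (fun x => dot (v x) (v x)) =
    integral_Omega Omega (fun x => (v x).1 ^+ 2) +
    integral_Omega Omega (fun x => (v x).2 ^+ 2).
  by move=> v2; rewrite integral_dot.
have -> : (fun x => (a * phi x + b * psi x - (a * h x + b * g x)) ^+ 2) =
    (fun x => (a * (phi x - h x) + b * (psi x - g x)) ^+ 2).
  by apply/funext => x; congr (_ ^+ 2); ring.
(* The gradient error of the combination is the combination of the errors. *)
pose E x := a *: (grad phi x - Dh x) + b *: (grad psi x - Dg x).
have -> : (fun x => dot (grad (fun x => a * phi x + b * psi x) x -
      (a *: Dh x + b *: Dg x)) (grad (fun x => a * phi x + b * psi x) x -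
      (a *: Dh x + b *: Dg x))) = (fun x => dot (E x) (E x)).
  apply/funext => x; rewrite /dot /grad/= !dl /E /grad/=.
  by congr (_ * _ + _ * _); rewrite /GRing.scale/=; ring.
rewrite dot2; last by apply: L2v_lin; apply: L2v_sub.
rewrite dot2 in ephi; last exact: L2v_sub.
rewrite dot2 in epsi; last exact: L2v_sub.
apply: (@le_lt_trans _ _ (2 * a ^+ 2 * (e / C) + 2 * b ^+ 2 * (e / C))).
  have A := ler_wpM2l (_ : 0 <= 2 * a ^+ 2) (ltW ephi).
  have B := ler_wpM2l (_ : 0 <= 2 * b ^+ 2) (ltW epsi).
  have {}A := A (mulr_ge0 (ler0n _ 2) (sqr_ge0 a)).
  have {}B := B (mulr_ge0 (ler0n _ 2) (sqr_ge0 b)).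
  apply: le_trans (lerD A B).
  apply: le_trans (lerD I1 (lerD I2 I3)) _.
  by rewrite le_eqVlt; apply/orP; left; apply/eqP => /=; ring.
rewrite -mulrDl mulrA ltr_pdivrMr// mulrC ltr_pM2l// /C; lra.
Qed.

(** V is a vector space, so that the averages u_{n,beta} are admissible test
    fields with the averaged gradients as their gradients. *)
Lemma inV_lin (a b : R) (v w : vfield R) (Dv Dw : gfield R) :
  inV Omega v Dv -> inV Omega w Dw ->
  inV Omega (fun x => a *: v x + b *: w x) (fun x => a *: Dv x + b *: Dw x).
Proof.
move=> [v1 v2 dv] [w1 w2 dw]; split.
- exact: (H10_lin a b _ _ _ _ v1 w1).
- exact: (H10_lin a b _ _ _ _ v2 w2).
- apply: filterS2 dv dw => x Hv Hw Ox /=.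
  have := Hv Ox; have := Hw Ox; rewrite /GRing.scale/= => A B.
  transitivity (a * ((Dv x).1.1 + (Dv x).2.2) + b * ((Dw x).1.1 + (Dw x).2.2)).
    by ring.
  by rewrite A B !mulr0 addr0.
Qed.

End SobolevLinear.

(** * The convection term *)

Section Damping.
Context {R : realType}.
Implicit Types eps a b : R.

(** Derivative of s |-> s / (1 + eps s) at s = a^2 + b^2. *)
Definition damping eps a b : R := (1 + eps * (a ^+ 2 + b ^+ 2))^-1 ^+ 2.

Lemma damping_den_ge1 eps a b : 0 <= eps -> 1 <= 1 + eps * (a ^+ 2 + b ^+ 2).
Proof.
by move=> e0; rewrite lerDl mulr_ge0// addr_ge0// sqr_ge0.
Qed.

Lemma damping_den_gt0 eps a b : 0 <= eps -> 0 < 1 + eps * (a ^+ 2 + b ^+ 2).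
Proof. by move=> /(damping_den_ge1 _ a b); apply: lt_le_trans. Qed.

Lemma damping_ge0 eps a b : 0 <= damping eps a b.
Proof. exact: sqr_ge0. Qed.

Lemma damping_le1 eps a b : 0 <= eps -> damping eps a b <= 1.
Proof.
move=> e0; rewrite /damping exprVn invf_le1 ?exprn_ege1 ?damping_den_ge1//.
by rewrite exprn_gt0// damping_den_gt0.
Qed.

(** |a| <= 1 + a^2 <= (1 + 1/eps) (1 + eps (a^2 + b^2)): already one of the two
    factors of the damping suffices to control a. *)
Lemma damping_bounded eps a b : 0 < eps ->
  `|damping eps a b * a| <= 1 + eps^-1.
Proof.
move=> e0; set D := 1 + eps * (a ^+ 2 + b ^+ 2).
have D1 : 1 <= D by exact/damping_den_ge1/ltW.
have D0 : 0 < D by exact: lt_le_trans D1.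
have aD : `|a| <= (1 + eps^-1) * D.
  have : `|a| <= 1 + a ^+ 2.
    by rewrite ler_norml; apply/andP; split; nra.
  move/le_trans; apply.
  have -> : (1 + eps^-1) * D = 1 + a ^+ 2 + b ^+ 2 + eps * (a ^+ 2 + b ^+ 2) + eps^-1.
    by rewrite /D; field; rewrite gt_eqF.
  have := sqr_ge0 a; have := sqr_ge0 b; have : 0 < eps^-1 by rewrite invr_gt0.
  nra.
rewrite normrM (ger0_norm (damping_ge0 _ _ _)) /damping -/D.
rewrite exprVn mulrC ler_pdivrMr ?exprn_gt0//; apply: le_trans aD _.
have : 0 < 1 + eps^-1 by rewrite addr_gt0// invr_gt0.
by move: (1 + _) => c c0; rewrite ler_pM2l// expr2 ler_peMl// ltW.
Qed.

(** Joint continuity, including at eps = 0, where the damping disappears. *)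
Lemma damping_cvg {T : Type} {F : set_system T} {FF : Filter F} (e a b : T -> R)
    (e0 a0 b0 : R) : 0 <= e0 ->
  e @ F --> e0 -> a @ F --> a0 -> b @ F --> b0 ->
  (fun t => damping (e t) (a t) (b t)) @ F --> damping e0 a0 b0.
Proof.
move=> e00 ce ca cb; rewrite /damping.
have cinv : (fun t => (1 + e t * (a t ^+ 2 + b t ^+ 2))^-1) @ F -->
    (1 + e0 * (a0 ^+ 2 + b0 ^+ 2))^-1.
  apply: cvgV; first by rewrite gt_eqF// damping_den_gt0.
  apply: cvgD; first exact: cvg_cst.
  by apply: cvgM => //; apply: cvgD; rewrite !expr2; apply: cvgM.
rewrite expr2; under eq_fun do rewrite expr2; exact: cvgM.
Qed.

Lemma measurable_fun_inv_gt0 d (T : measurableType d) (D : set T) (q : T -> R) :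
  measurable_fun D q -> (forall x, 0 < q x) -> measurable_fun D (fun x => (q x)^-1).
Proof.
move=> mq q0; have minv : measurable_fun (`]0, +oo[%classic : set R) (@GRing.inv R).
  apply: open_continuous_measurable_fun; first exact: interval_open.
  move=> x; rewrite inE/= in_itv/= andbT => x0; apply: cvgV => //.
  by rewrite gt_eqF.
apply: (measurable_comp _ _ minv mq); first exact: measurable_itv.
by move=> _ [x _ <-]/=; rewrite in_itv/= andbT.
Qed.

Lemma measurable_damping d (T : measurableType d) (D : set T) eps (a b : T -> R) :
  0 <= eps -> measurable_fun D a -> measurable_fun D b ->
  measurable_fun D (fun x => damping eps (a x) (b x)).
Proof.
move=> e0 ma mb; apply: measurable_funX; apply: measurable_fun_inv_gt0.
  apply: measurable_funD; first exact: measurable_cst.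
  apply: measurable_funM; first exact: measurable_cst.
  by apply: measurable_funD; exact: measurable_funX.
by move=> x; exact: damping_den_gt0.
Qed.

(** The squares are written as products so that the product rules for
    differentiability and derivatives apply to them directly. *)
Definition damped_energy {V : Type} eps (phi1 phi2 : V -> R) (x : V) : R :=
  (phi1 x * phi1 x + phi2 x * phi2 x) *
  (1 + eps * (phi1 x * phi1 x + phi2 x * phi2 x))^-1.

Lemma damped_energy_den_gt0 (V : Type) eps (phi1 phi2 : V -> R) x : 0 <= eps ->
  0 < 1 + eps * (phi1 x * phi1 x + phi2 x * phi2 x).
Proof. exact: damping_den_gt0. Qed.

Lemma Ck_damped_energy (V : normedModType R) k eps (phi1 phi2 : V -> R) :
  0 <= eps -> Ck k phi1 -> Ck k phi2 -> Ck k (damped_energy eps phi1 phi2).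
Proof.
move=> e0 c1 c2.
have cs : Ck k (fun x => phi1 x * phi1 x + phi2 x * phi2 x).
  by apply: CkD; exact: CkM.
apply: CkM => //; apply: CkV.
  by move=> x; rewrite gt_eqF// damped_energy_den_gt0.
by apply: CkD; [exact: Ck_cst|apply: CkM => //; exact: Ck_cst].
Qed.

(** Chain rule; the damping comes from
    s' / q - eps s s' / q^2 = s' / q^2 with q = 1 + eps s. *)
Lemma derive_damped_energy (V : normedModType R) eps (phi1 phi2 : V -> R) v x :
  0 <= eps -> differentiable phi1 x -> differentiable phi2 x ->
  'D_v (damped_energy eps phi1 phi2) x =
  2 * (damping eps (phi1 x) (phi2 x) * phi1 x * 'D_v phi1 x +
       damping eps (phi2 x) (phi1 x) * phi2 x * 'D_v phi2 x).
Proof.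
move=> e0 d1 d2.
pose s y := phi1 y * phi1 y + phi2 y * phi2 y.
have ds : differentiable s x by apply: differentiableD; exact: differentiableM.
have Ds : 'D_v s x = 2 * (phi1 x * 'D_v phi1 x + phi2 x * 'D_v phi2 x).
  rewrite /s [LHS](@deriveD _ _ _ (fun y => phi1 y * phi1 y) (fun y => phi2 y * phi2 y));
    [|by apply: diff_derivable; exact: differentiableM..].
  by rewrite !derive_mul//; ring.
pose q y := 1 + eps * s y.
have q0 : q x != 0 by rewrite gt_eqF// /q damped_energy_den_gt0.
have dq : differentiable q x.
  apply: differentiableD; first exact: differentiable_cst.
  by apply: differentiableM => //; exact: differentiable_cst.
have Dq : 'D_v q x = eps * 'D_v s x.
  rewrite /q [LHS](@deriveD _ V R (fun _ : V => 1 : R) (fun y => eps * s y)).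
  - by rewrite derive_cst add0r deriveZ//; exact: diff_derivable.
  - exact: derivable_cst.
  - by apply: derivableZ; exact: diff_derivable.
rewrite [LHS](derive_mul _ _ s (fun y => (q y)^-1))//; last exact: differentiableV.
rewrite deriveV//; last exact: diff_derivable.
rewrite Dq Ds /damping [phi2 x ^+ 2 + _]addrC.
have <- : q x = 1 + eps * (phi1 x ^+ 2 + phi2 x ^+ 2) by rewrite /q /s !expr2.
have -> : s x = phi1 x ^+ 2 + phi2 x ^+ 2 by rewrite /s !expr2.
have qE : q x = 1 + eps * (phi1 x ^+ 2 + phi2 x ^+ 2) by rewrite /q /s !expr2.
rewrite /GRing.scale/=.
move: (q x) q0 qE => Q Q0 QE.
transitivity (Q^-1 ^+ 2 * (2 * (phi1 x * 'D_v phi1 x + phi2 x * 'D_v phi2 x)) *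
   (Q - eps * (phi1 x ^+ 2 + phi2 x ^+ 2))).
  by field.
by rewrite [X in X - _]QE addrK mulr1; ring.
Qed.

End Damping.

Section Trilinear.
Context (R : realType).
Local Notation plane := (measurableTypeR R * measurableTypeR R)%type.
Variables (Omega : set (R * R)).
Hypothesis oO : open Omega.

Let mO : @measurable _ plane Omega.
Proof. exact: open_plane_measurable. Qed.

Local Notation integrableO h := (@integrable _ plane R mu2 Omega (EFin \o h)).

(** Integrating by parts with the weak gradients of the two components leaves
    minus the integral of (div v) psi. *)
Lemma inV_div_test (v : vfield R) (Dv : gfield R) psi :
  inV Omega v Dv -> test_function Omega psi ->
  integral_Omega Omega (fun x => dot (v x) (grad psi x)) = 0.
Proof.
move=> [[[v1 [D11 _] w1] _] [[v2 [_ D22] w2] _] dv] tpsi.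
have p2 := test_function_L2 _ _ _ oO tpsi.
rewrite integral_dot//; last exact: test_function_grad_L2.
have [-> _] := w1 _ tpsi; have [_ ->] := w2 _ tpsi.
have i1 := L2M _ _ oO _ _ D11 p2; have i2 := L2M _ _ oO _ _ D22 p2.
transitivity (- integral_Omega Omega
    (fun x => ((Dv x).1.1 + (Dv x).2.2) * psi x)).
  rewrite -opprD; congr (- _); rewrite -[LHS](RintegralD mO i1 i2).
  by congr (Rintegral _ _ _); apply/funext => x /=; ring.
apply/eqP; rewrite oppr_eq0; apply/eqP.
transitivity (integral_Omega Omega (fun=> 0)); last first.
  by rewrite /integral_Omega Rintegral_cst// mul0r.
have [mp _] := p2; have [m1 _] := D11; have [m2 _] := D22.
apply: (Rintegral_ae_eq mO).
- by apply: measurable_funM => //; exact: measurable_funD.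
- exact: measurable_cst.
- by apply: filterS dv => x H Ox; rewrite H// mul0r.
Qed.

(** The rate 2^-(n+1) makes the squared errors summable, as
    [square_integrable_fast_dominated] requires. *)
Lemma H10_fast_approx (h : R * R -> R) (Dh : vfield R) : H10 Omega h Dh ->
  exists phi : nat -> R * R -> R, forall n,
    [/\ test_function Omega (phi n),
        integral_Omega Omega (fun x => (phi n x - h x) ^+ 2) <= 1 / (2 ^ n.+1)%:R,
        integral_Omega Omega (fun x => ((grad (phi n) x).1 - (Dh x).1) ^+ 2) <=
          1 / (2 ^ n.+1)%:R &
        integral_Omega Omega (fun x => ((grad (phi n) x).2 - (Dh x).2) ^+ 2) <=
          1 / (2 ^ n.+1)%:R].
Proof.
move=> [[h2 Dh2 _] ha].
suff /choice[phi P] : forall n : nat, exists phi : R * R -> R,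
    [/\ test_function Omega phi,
        integral_Omega Omega (fun x => (phi x - h x) ^+ 2) <= 1 / (2 ^ n.+1)%:R,
        integral_Omega Omega (fun x => ((grad phi x).1 - (Dh x).1) ^+ 2) <=
          1 / (2 ^ n.+1)%:R &
        integral_Omega Omega (fun x => ((grad phi x).2 - (Dh x).2) ^+ 2) <=
          1 / (2 ^ n.+1)%:R] by exists phi.
move=> n; have [|phi tphi] := ha (1 / (2 ^ n.+1)%:R).
  by rewrite divr_gt0// ltr0n expn_gt0.
have g2 := test_function_grad_L2 _ _ _ oO tphi.
have d2 := L2v_sub _ _ oO _ _ g2 Dh2.
rewrite integral_dot// => /ltW le_e.
exists phi; split => //; apply: le_trans le_e.
- by rewrite lerDl addr_ge0//; apply: Rintegral_ge0 => x _; rewrite -expr2 sqr_ge0.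
- rewrite addrCA lerDl addr_ge0//; apply: Rintegral_ge0 => x _;
    by rewrite -?expr2 sqr_ge0.
- rewrite addrA lerDr addr_ge0//; apply: Rintegral_ge0 => x _;
    by rewrite -?expr2 sqr_ge0.
Qed.

Lemma integrable_sum4 (A B C D : R * R -> R) :
  integrableO A -> integrableO B -> integrableO C -> integrableO D ->
  integrableO (fun x => A x + B x + (C x + D x)) /\
  integral_Omega Omega (fun x => A x + B x + (C x + D x)) =
  integral_Omega Omega A + integral_Omega Omega B +
  (integral_Omega Omega C + integral_Omega Omega D).
Proof.
move=> iA iB iC iD.
have iAB : integrableO (fun x => A x + B x) := integrableD mO iA iB.
have iCD : integrableO (fun x => C x + D x) := integrableD mO iC iD.
split; first exact: (integrableD mO iAB iCD).
by rewrite [LHS](RintegralD mO iAB iCD); congr (_ + _); exact: RintegralD.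
Qed.

Lemma integrable_bounded_L2M (B : R) (p w g : R * R -> R) :
  @measurable_fun _ _ plane (measurableTypeR R) Omega p ->
  (forall x, `|p x| <= B) -> L2 Omega w -> L2 Omega g ->
  integrableO (fun x => p x * (w x * g x)).
Proof.
move=> mp pB w2 g2; have wg := L2M _ _ oO _ _ w2 g2.
have /integrableP[/measurable_EFinP mwg _] := wg.
apply: (integrable_dominated _ _ _ _ _ mO _ (fun x => B * `|w x * g x|)).
- exact: measurable_funM.
- by move=> x _; rewrite normrM ler_wpM2r.
- exact: (integrableZl mO B (integrable_norm wg)).
Qed.

Lemma L2_fast_ae_cvg (phi : nat -> R * R -> R) (h : R * R -> R) :
  (forall n, L2 Omega (phi n)) -> L2 Omega h ->
  (forall n, integral_Omega Omega (fun x => (phi n x - h x) ^+ 2) <=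
    1 / (2 ^ n.+1)%:R) ->
  {ae (@mu2 R), forall x, Omega x -> phi ^~ x @ \oo --> h x}.
Proof.
move=> phi2 h2 e.
have [S [_ HS]] := square_integrable_fast_dominated _ _ _ _ _ mO
  (fun n x => phi n x - h x) (fun n => L2_sub _ _ oO _ _ (phi2 n) h2) e.
by apply: filterS HS => x H Ox; have [_] := H Ox; move/subr_cvg0.
Qed.

(** The integrand is half of v . grad (|v|^2 / (1 + eps |v|^2)).  The identity
    holds with the two components of v in the damped energy replaced by test
    functions, and each of the four products making up the integrand converges
    along fast approximations of the components. *)
Lemma damped_transport_eq0 (eps : R) (v : vfield R) (Dv : gfield R) :
  0 < eps -> inV Omega v Dv ->
  integral_Omega Omega (fun x => damping eps (v x).1 (v x).2 *
    dot (dot (v x) (Dv x).1, dot (v x) (Dv x).2) (v x)) = 0.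
Proof.
move=> eps0 vV; have eps1 := ltW eps0.
have [V1 V2 _] := vV.
have [[v1 [D11 D12] _] _] := V1; have [[v2 [D21 D22] _] _] := V2.
have [f1 F1] := H10_fast_approx _ _ V1; have [f2 F2] := H10_fast_approx _ _ V2.
have t1 n : test_function Omega (f1 n) by have [] := F1 n.
have t2 n : test_function Omega (f2 n) by have [] := F2 n.
have L1 n := test_function_L2 _ _ _ oO (t1 n).
have L2' n := test_function_L2 _ _ _ oO (t2 n).
have G1 n := test_function_grad_L2 _ _ _ oO (t1 n).
have G2 n := test_function_grad_L2 _ _ _ oO (t2 n).
have cv1 : {ae (@mu2 R), forall x, Omega x -> f1 ^~ x @ \oo --> (v x).1}.
  by apply: L2_fast_ae_cvg => // n; have [] := F1 n.
have cv2 : {ae (@mu2 R), forall x, Omega x -> f2 ^~ x @ \oo --> (v x).2}.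
  by apply: L2_fast_ae_cvg => // n; have [] := F2 n.
pose p (a b : R * R -> R) x := damping eps (a x) (b x) * a x.
have pB a b x : `|p a b x| <= 1 + eps^-1 by exact: damping_bounded.
have mp (a b : R * R -> R) : L2 Omega a -> L2 Omega b ->
    @measurable_fun _ _ plane (measurableTypeR R) Omega (p a b).
  move=> [ma _] [mb _]; apply: measurable_funM => //.
  exact: measurable_damping.
pose p1 n := p (f1 n) (f2 n); pose p2 n := p (f2 n) (f1 n).
pose q1 := p (fst \o v) (snd \o v); pose q2 := p (snd \o v) (fst \o v).
have cp1 : {ae (@mu2 R), forall x, Omega x -> p1 ^~ x @ \oo --> q1 x}.
  apply: filterS2 cv1 cv2 => x H1 H2 Ox; apply: cvgM; last exact: H1.
  by apply: damping_cvg => //; [exact: cvg_cst|exact: H1|exact: H2].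
have cp2 : {ae (@mu2 R), forall x, Omega x -> p2 ^~ x @ \oo --> q2 x}.
  apply: filterS2 cv1 cv2 => x H1 H2 Ox; apply: cvgM; last exact: H2.
  by apply: damping_cvg => //; [exact: cvg_cst|exact: H2|exact: H1].
have DCT := @Rintegral_cvg_bounded_square_integrable _ plane R mu2 Omega mO (1 + eps^-1).
have [i11 l11] := DCT p1 (fun n x => (grad (f1 n) x).1) q1 (fst \o v)
  (fun x => (Dv x).1.1) (fun n => mp _ _ (L1 n) (L2' n)) (mp _ _ v1 v2)
  (fun n x => pB _ _ x) cp1 v1 D11 (fun n => (G1 n).1)
  (fun n => let: And4 _ _ H _ := F1 n in H).
have [i12 l12] := DCT p1 (fun n x => (grad (f1 n) x).2) q1 (snd \o v)
  (fun x => (Dv x).1.2) (fun n => mp _ _ (L1 n) (L2' n)) (mp _ _ v1 v2)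
  (fun n x => pB _ _ x) cp1 v2 D12 (fun n => (G1 n).2)
  (fun n => let: And4 _ _ _ H := F1 n in H).
have [i21 l21] := DCT p2 (fun n x => (grad (f2 n) x).1) q2 (fst \o v)
  (fun x => (Dv x).2.1) (fun n => mp _ _ (L2' n) (L1 n)) (mp _ _ v2 v1)
  (fun n x => pB _ _ x) cp2 v1 D21 (fun n => (G2 n).1)
  (fun n => let: And4 _ _ H _ := F2 n in H).
have [i22 l22] := DCT p2 (fun n x => (grad (f2 n) x).2) q2 (snd \o v)
  (fun x => (Dv x).2.2) (fun n => mp _ _ (L2' n) (L1 n)) (mp _ _ v2 v1)
  (fun n x => pB _ _ x) cp2 v2 D22 (fun n => (G2 n).2)
  (fun n => let: And4 _ _ _ H := F2 n in H).
have [_ E] := integrable_sum4 _ _ _ _ i11 i12 i21 i22.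
have -> : (fun x => damping eps (v x).1 (v x).2 *
    dot (dot (v x) (Dv x).1, dot (v x) (Dv x).2) (v x)) = (fun x =>
    q1 x * ((fst \o v) x * (Dv x).1.1) + q1 x * ((snd \o v) x * (Dv x).1.2) +
    (q2 x * ((fst \o v) x * (Dv x).2.1) + q2 x * ((snd \o v) x * (Dv x).2.2))).
  apply/funext => x; rewrite /q1 /q2 /p /dot/=.
  have -> : damping eps (v x).2 (v x).1 = damping eps (v x).1 (v x).2.
    by rewrite /damping [(v x).2 ^+ 2 + _]addrC.
  by ring.
have Z n :
    Rintegral mu2 Omega (fun x => p1 n x * ((fst \o v) x * (grad (f1 n) x).1)) +
    Rintegral mu2 Omega (fun x => p1 n x * ((snd \o v) x * (grad (f1 n) x).2)) +
    (Rintegral mu2 Omega (fun x => p2 n x * ((fst \o v) x * (grad (f2 n) x).1)) +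
     Rintegral mu2 Omega (fun x => p2 n x * ((snd \o v) x * (grad (f2 n) x).2))) = 0.
  have [/(_ _)c1 _ _] := t1 n; have [/(_ _)c2 _ _] := t2 n.
  have tpsi : test_function Omega (damped_energy eps (f1 n) (f2 n)).
    apply: test_function_support (t1 n) (t2 n) _ _.
      by move=> k; apply: Ck_damped_energy.
    by move=> x z1 z2; rewrite /damped_energy z1 z2 !mul0r addr0 mul0r.
  have := inV_div_test _ _ _ vV tpsi.
  have [A1 A2] := G1 n; have [B1 B2] := G2 n.
  have [iS <-] := integrable_sum4 _ _ _ _
    (integrable_bounded_L2M _ _ _ _ (mp _ _ (L1 n) (L2' n)) (pB _ _) v1 A1)
    (integrable_bounded_L2M _ _ _ _ (mp _ _ (L1 n) (L2' n)) (pB _ _) v2 A2)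
    (integrable_bounded_L2M _ _ _ _ (mp _ _ (L2' n) (L1 n)) (pB _ _) v1 B1)
    (integrable_bounded_L2M _ _ _ _ (mp _ _ (L2' n) (L1 n)) (pB _ _) v2 B2).
  have -> : (fun x => dot (v x) (grad (damped_energy eps (f1 n) (f2 n)) x)) =
    (fun x => 2 * (p1 n x * ((fst \o v) x * (grad (f1 n) x).1) +
      p1 n x * ((snd \o v) x * (grad (f1 n) x).2) +
      (p2 n x * ((fst \o v) x * (grad (f2 n) x).1) +
      p2 n x * ((snd \o v) x * (grad (f2 n) x).2)))).
    apply/funext => x; rewrite /dot /grad/=.
    have d1 := Ck_diff _ _ _ _ (c1 1%N) x; have d2 := Ck_diff _ _ _ _ (c2 1%N) x.
    by rewrite !derive_damped_energy// /p1 /p2 /p; ring.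
  rewrite [LHS](RintegralZl 2 mO iS) => /eqP.
  by rewrite mulf_eq0 pnatr_eq0/= => /eqP.
pose proof (cvgD (cvgD l11 l12) (cvgD l21 l22)) as C.
have Z0 := funext Z.
rewrite E -[LHS](cvg_lim (@Rhausdorff R) C).
rewrite [X in lim (X @ _)](_ : _ = (fun=> 0)); first exact: (lim_cst (@Rhausdorff R)).
exact: Z0.
Qed.

(** When the integrand is integrable, the undamped identity follows from the
    damped ones with eps = 1/(n+1) by dominated convergence, the damping lying
    between 0 and 1.  When it is not, one of the integrals of its positive and
    negative parts is infinite and the real-valued integral is 0 by
    convention. *)
Lemma trilinear_b_self_eq0 (v : vfield R) (Dv : gfield R) :
  inV Omega v Dv -> trilinear_b Omega v Dv v = 0.
Proof.
move=> vV; have [[[v1 [D11 D12] _] _] [[v2 [D21 D22] _] _] _] := vV.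
rewrite /trilinear_b; set w := (fun x => dot _ (v x)).
have mw : @measurable_fun _ _ plane (measurableTypeR R) Omega w.
  have [[mv1 _] [mv2 _]] := (v1, v2).
  have [[m11 _] [m12 _]] := (D11, D12); have [[m21 _] [m22 _]] := (D21, D22).
  by apply: measurable_funD; apply: measurable_funM => //;
    apply: measurable_funD; exact: measurable_funM.
have [iw|niw] := boolP (`[< integrableO w >]); last first.
  have fine0 (y : \bar R) : (y \isn't a fin_num)%E -> fine y = 0 by case: y.
  apply: fine0; apply: contra niw; rewrite -integral_fin_num_abs// => wy.
  by apply/asboolP/integrableP; split => //; exact/measurable_EFinP.
move/asboolP in iw.
have h0 n : 0 <= @harmonic R n by exact: harmonic_ge0.
pose h_ n x := damping (harmonic n) (v x).1 (v x).2 * w x.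
have mh n : @measurable_fun _ _ plane (measurableTypeR R) Omega (h_ n).
  by apply: measurable_funM => //; apply: measurable_damping => //;
    [exact: v1.1|exact: v2.1].
have ch : {ae (@mu2 R), forall x, Omega x -> h_ ^~ x @ \oo --> w x}.
  apply: aeW => x _.
  have d1 : damping 0 (v x).1 (v x).2 = 1.
    by rewrite /damping mul0r addr0 invr1 expr1n.
  rewrite -[X in _ --> X]mul1r -d1; apply: cvgM; last exact: cvg_cst.
  by apply: damping_cvg => //; [exact: cvg_harmonic|exact: cvg_cst|exact: cvg_cst].
have bh : {ae (@mu2 R), forall x n, Omega x -> `|h_ n x| <= `|w x|}.
  apply: aeW => x n _; rewrite normrM ger0_norm ?damping_ge0// ler_piMl//.
  exact: damping_le1.
have [_ C] := Rintegral_dominated_cvg mO h_ w _ mh mw ch (integrable_norm iw) bh.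
have Z0 := funext (fun n => damped_transport_eq0 _ _ _ (@harmonic_gt0 R n) vV).
rewrite -[LHS](cvg_lim (@Rhausdorff R) C).
rewrite [X in lim (X @ _)](_ : _ = (fun=> 0)); first exact: (lim_cst (@Rhausdorff R)).
exact: Z0.
Qed.

End Trilinear.

(** * The energy inequality *)

Section InnerProduct.
Context (R : realType) (Omega : set (R * R)).
Hypothesis oO : open Omega.
Local Notation plane := (measurableTypeR R * measurableTypeR R)%type.
Let mO : @measurable _ plane Omega.
Proof. exact: open_plane_measurable. Qed.

Lemma ipC (v w : vfield R) : ip Omega v w = ip Omega w v.
Proof.
congr (integral_Omega _ _); apply/funext => x.
by rewrite /dot mulrC [_.2 * _]mulrC.
Qed.

Lemma ip_linl (a b : R) (v w z : vfield R) :
  L2v Omega v -> L2v Omega w -> L2v Omega z ->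
  ip Omega (fun x => a *: v x + b *: w x) z = a * ip Omega v z + b * ip Omega w z.
Proof.
move=> v2 w2 z2.
rewrite /ip -integral_lin//; [|exact: L2v_dot|exact: L2v_dot].
congr (integral_Omega _ _); apply/funext => x.
by rewrite /dot/= /GRing.scale/=; ring.
Qed.

Lemma ip_linr (a b : R) (v w z : vfield R) :
  L2v Omega v -> L2v Omega w -> L2v Omega z ->
  ip Omega z (fun x => a *: v x + b *: w x) = a * ip Omega z v + b * ip Omega z w.
Proof. by move=> v2 w2 z2; rewrite ipC ip_linl// !(ipC z). Qed.

Lemma ip_ge0 (v : vfield R) : 0 <= ip Omega v v.
Proof.
by apply: Rintegral_ge0 => x _; rewrite addr_ge0// -expr2 sqr_ge0.
Qed.

Lemma ipg_ge0 (Dv : gfield R) : 0 <= ipg Omega Dv Dv.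
Proof.
by apply: Rintegral_ge0 => x _; rewrite !addr_ge0// -expr2 sqr_ge0.
Qed.

Lemma sqr_normL2 (v : vfield R) : normL2 Omega v ^+ 2 = ip Omega v v.
Proof. by rewrite sqr_sqrtr// ip_ge0. Qed.

Lemma ip_young (s : R) (v w : vfield R) : 0 < s -> L2v Omega v -> L2v Omega w ->
  2 * ip Omega v w <= s * ip Omega v v + s^-1 * ip Omega w w.
Proof.
move=> s0 v2 w2; rewrite /ip !integral_dot//.
have sqrE (h : R * R -> R) : (fun x => h x * h x) = (fun x => h x ^+ 2).
  by apply/funext => x; rewrite expr2.
have [v1 v2'] := v2; have [w1 w2'] := w2.
have Y1 := Rintegral_young mO s0 v1 w1.
have Y2 := Rintegral_young mO s0 v2' w2'.
rewrite !mulrDr addrACA; apply: lerD.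
  move: Y1; rewrite /integral_Omega -!sqrE; exact.
move: Y2; rewrite /integral_Omega -!sqrE; exact.
Qed.

(** Squared form of the Poincare inequality, free of square roots. *)
Lemma poincare_sqr (lambda : R) (v : vfield R) (Dv : gfield R) : 0 < lambda ->
  poincare Omega lambda -> inV Omega v Dv ->
  lambda * ip Omega v v <= ipg Omega Dv Dv.
Proof.
move=> l0 P /P; rewrite ler_pdivlMl ?sqrtr_gt0// => H.
have -> : lambda * ip Omega v v = (Num.sqrt lambda * normL2 Omega v) ^+ 2.
  by rewrite exprMn sqr_normL2 sqr_sqrtr ?ltW.
have -> : ipg Omega Dv Dv = normg Omega Dv ^+ 2 by rewrite sqr_sqrtr// ipg_ge0.
by rewrite ler_pXn2r// nnegrE ?mulr_ge0// sqrtr_ge0.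
Qed.

Lemma inV_L2v (v : vfield R) (Dv : gfield R) : inV Omega v Dv -> L2v Omega v.
Proof. by move=> [[[? _ _] _] [[? _ _] _] _]. Qed.

End InnerProduct.

Section Comb.
Context (R : realType).

(** The three-term combination as nested two-term ones, the shape on which the
    linearity lemmas act. *)
Lemma comb_funE (T : Type) (E : lmodType R) (c : nat -> R) (z : nat -> T -> E) m :
  (comb c z m.+1 : T -> E) =
  (fun x => 1 *: (c 0%N *: z m x + c 1%N *: z m.+1 x) + c 2%N *: z m.+2 x).
Proof.
rewrite /comb !big_ord_recr big_ord0 /= subn1/= addn0 addn1 addn2 add0r.
by apply/funext => x; rewrite scale1r.
Qed.

End Comb.

Section Energy.
Context (R : realType) (Omega : set (R * R)).
Hypothesis oO : open Omega.

Lemma inV_comb (c : nat -> R) (u : nat -> vfield R) (Du : nat -> gfield R) m :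
  (forall n, inV Omega (u n) (Du n)) ->
  inV Omega (combv c u m.+1) (combg c Du m.+1).
Proof.
move=> uV; rewrite /combv /combg !comb_funE.
by do 2 apply: inV_lin => //.
Qed.

Lemma ip_comb (c e : nat -> R) (u : nat -> vfield R) m :
  (forall n, L2v Omega (u n)) ->
  ip Omega (combv c u m.+1) (combv e u m.+1) =
  c 0%N * e 0%N * ip Omega (u m) (u m) +
  c 1%N * e 1%N * ip Omega (u m.+1) (u m.+1) +
  c 2%N * e 2%N * ip Omega (u m.+2) (u m.+2) +
  (c 0%N * e 1%N + c 1%N * e 0%N) * ip Omega (u m) (u m.+1) +
  (c 0%N * e 2%N + c 2%N * e 0%N) * ip Omega (u m) (u m.+2) +
  (c 1%N * e 2%N + c 2%N * e 1%N) * ip Omega (u m.+1) (u m.+2).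
Proof.
move=> u2; rewrite /combv !comb_funE.
have L k l (a b : R) : L2v Omega (fun x => a *: u k x + b *: u l x).
  exact: L2v_lin.
rewrite !(ip_linl, ip_linr)//; try (by do ?apply: L2v_lin => //).
rewrite (ipC _ _ (u m.+1) (u m)) (ipC _ _ (u m.+2) (u m)).
rewrite (ipC _ _ (u m.+2) (u m.+1)); ring.
Qed.

(** G-stability of the scheme: both sides are quadratic forms in the inner products
    of the three iterates, and a_1^2 = theta (1 - theta^2) / 2 makes their
    coefficients agree. *)
Lemma G_identity (theta : R) (u : nat -> vfield R) m : 0 < theta < 1 ->
  (forall n, L2v Omega (u n)) ->
  ip Omega (combv (alpha theta) u m.+1) (combv (beta theta) u m.+1) =
  Gnorm2 Omega theta (u m.+2) (u m.+1) - Gnorm2 Omega theta (u m.+1) (u m) +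
  normL2 Omega (combv (a_coef theta) u m.+1) ^+ 2.
Proof.
move=> /andP[t0 t1] u2.
rewrite /Gnorm2 !sqr_normL2 !ip_comb// /alpha /beta /a_coef/=.
have : Num.sqrt (theta * (1 - theta ^+ 2) / 2) ^+ 2 = theta * (1 - theta ^+ 2) / 2.
  by rewrite sqr_sqrtr// divr_ge0// mulr_ge0//; [lra|nra].
move: (Num.sqrt _) => s s2.
set i00 := ip _ _ (u m); set i11 := ip _ _ (u m.+1); set i22 := ip _ _ (u m.+2).
set i01 := ip _ (u m) (u m.+1); set i02 := ip _ (u m) (u m.+2).
set i12 := ip _ (u m.+1) (u m.+2).
transitivity ((1 + theta) / 4 * i22 + (1 - theta) / 4 * i11 -
  ((1 + theta) / 4 * i11 + (1 - theta) / 4 * i00) +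
  s ^+ 2 * (i00 / 4 + i11 + i22 / 4 - i01 + i02 / 2 - i12)).
  by rewrite s2; field.
by field.
Qed.

(** The weights beta_l are nonnegative for theta in (0,1), since
    2 - theta - theta^2 = (1 - theta) (2 + theta). *)
Lemma t_beta_ge0 (theta dt : R) n : 0 < theta < 1 -> 0 <= dt ->
  0 <= t_beta theta dt n.
Proof.
move=> /andP[t0 t1] dt0; apply: sumr_ge0 => -[l /= lt3] _.
apply: mulr_ge0; last exact: mulr_ge0.
by case: l lt3 => [|[|[|//]]] _; rewrite /beta/= divr_ge0//; nra.
Qed.

(** Test with w = u_{n,beta}.  Young's inequality with weight 1 / (nu lambda1)
    costs (nu lambda1 / 2) |w|^2, and the Poincare inequality provides
    nu lambda1 |w|^2: the surplus pays for the dissipation term in the G-H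
    identity. *)
Lemma energy_step (nu lambda1 theta dt : R) (f : R -> vfield R)
    (u : nat -> vfield R) (Du : nat -> gfield R) (eps a b c h11 h22 F : R) m :
  0 < nu -> 0 < lambda1 -> poincare Omega lambda1 -> 0 < theta < 1 -> 0 < dt ->
  dln_scheme Omega nu theta dt f u Du ->
  L2v Omega (f (t_beta theta dt m.+1)) ->
  normL2 Omega (f (t_beta theta dt m.+1)) <= F ->
  GH_identity Omega nu lambda1 theta dt u eps a b c h11 h22 ->
  (1 + eps) * Hnorm2 Omega h11 h22 (u m.+2) (u m.+1) <=
  Hnorm2 Omega h11 h22 (u m.+1) (u m) + dt / (2 * nu * lambda1) * F ^+ 2.
Proof.
move=> nu0 l0 P t01 dt0 [uV scheme] f2 fF GH.
have u2 n : L2v Omega (u n) by exact: inV_L2v (uV n).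
pose w := combv (beta theta) u m.+1; pose Dw := combg (beta theta) Du m.+1.
have wV : inV Omega w Dw by exact: inV_comb.
have w2 : L2v Omega w := inV_L2v _ _ _ _ wV.
pose G1 := Gnorm2 Omega theta (u m.+2) (u m.+1).
pose G0 := Gnorm2 Omega theta (u m.+1) (u m).
pose s := normL2 Omega (combv (a_coef theta) u m.+1) ^+ 2.
have GHm : (1 + eps) * Hnorm2 Omega h11 h22 (u m.+2) (u m.+1) -
    Hnorm2 Omega h11 h22 (u m.+1) (u m) <=
    G1 - G0 + s + nu * dt * lambda1 / 2 * ip Omega w w.
  by rewrite -[ip Omega w w]sqr_normL2 [leRHS](GH m.+1 isT) lerDl sqr_ge0.
have E : dt^-1 * (G1 - G0 + s) + nu * ipg Omega Dw Dw =
    ip Omega (f (t_beta theta dt m.+1)) w.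
  have := scheme m.+1 isT _ _ wV.
  by rewrite trilinear_b_self_eq0// addr0 G_identity.
have Gs : G1 - G0 + s = dt *
    (ip Omega (f (t_beta theta dt m.+1)) w - nu * ipg Omega Dw Dw).
  by rewrite -E addrK mulrA divff ?mul1r// gt_eqF.
have nl0 : 0 < nu * lambda1 by exact: mulr_gt0.
have k0 : 0 < (nu * lambda1)^-1 by rewrite invr_gt0.
have Y := ip_young _ _ oO _ _ _ k0 f2 w2; rewrite invrK in Y.
have PW := ler_wpM2l (ltW nu0) (poincare_sqr _ _ _ _ _ l0 P wV).
have fF2 : ip Omega (f (t_beta theta dt m.+1)) (f (t_beta theta dt m.+1)) <= F ^+ 2.
  rewrite -sqr_normL2 ler_pXn2r// nnegrE ?sqrtr_ge0//.
  by apply: le_trans fF; exact: sqrtr_ge0.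
have kF := ler_wpM2l (ltW k0) fF2.
have -> : dt / (2 * nu * lambda1) * F ^+ 2 = dt * ((nu * lambda1)^-1 * F ^+ 2 / 2).
  by field; rewrite !gt_eqF.
have C : ip Omega (f (t_beta theta dt m.+1)) w - nu * ipg Omega Dw Dw +
    nu * lambda1 / 2 * ip Omega w w <= (nu * lambda1)^-1 * F ^+ 2 / 2 by lra.
have {}C := ler_wpM2l (ltW dt0) C.
rewrite Gs in GHm; lra.
Qed.

End Energy.

(** * Long-time bound *)

Section Threshold.
Context (R : realType).

(** The subtracted term makes the bound an exact solution of the recursion
    (1 + eps) x' = x + K, so that induction goes through with equality. *)
Lemma discrete_gronwall (eps K : R) (H : nat -> R) : 0 < eps ->
  (forall n, (1 + eps) * H n.+1 <= H n + K) ->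
  forall n, H n <= (1 + eps) ^- n * H 0%N + K / eps - (1 + eps) ^- n * (K / eps).
Proof.
move=> e0 step; have e1 : 0 < 1 + eps by rewrite addr_gt0.
elim=> [|n IH]; first by rewrite expr0 invr1; lra.
rewrite -(ler_pM2l e1); apply: le_trans (step n) _.
have := lerD IH (lexx K); move/le_trans; apply.
rewrite le_eqVlt; apply/orP; left; apply/eqP; rewrite exprS.
by field; rewrite ?expf_neq0 ?gt_eqF.
Qed.

(** With t = eps / 8 < 1/2, exp (2 t) <= (1 - t)^-2 because 1 - t <= exp (-t),
    and (1 + 8 t) (1 - t)^2 >= 1 on [0, 1/2]. *)
Lemma expR_quarter_le (eps : R) : 0 < eps -> eps < 4 -> expR (eps / 4) <= 1 + eps.
Proof.
move=> e0 e4; pose t := eps / 8.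
have t0 : 0 < t by rewrite divr_gt0.
have t2 : t < 2^-1 by rewrite /t; lra.
have lo : 0 < 1 - t by lra.
have et : expR t <= (1 - t)^-1.
  by rewrite -[t in expR t]opprK expRN lef_pV2 ?posrE ?expR_gt0// expR_ge1Dx.
have -> : eps / 4 = 2%:R * t by rewrite /t; field.
rewrite expRM_natl.
apply: (@le_trans _ _ ((1 - t)^-1 ^+ 2)).
  by rewrite ler_pXn2r ?nnegrE ?expR_ge0 ?invr_ge0 ?(ltW lo).
rewrite exprVn -[leLHS]mul1r ler_pdivrMr ?exprn_gt0//.
have -> : eps = 8 * t by rewrite /t; field.
nra.
Qed.

(** Exponential form of the threshold.  The conventions ln 0 = -oo and 1/0 = +oo
    leave nothing to prove for A = 0 and contradict the hypothesis when rho = 0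
    and A > 0. *)
Lemma lne_threshold (L A rho T : R) : 0 < L -> 0 <= A -> 0 <= rho ->
  (L%:E * lne (A%:E / rho%:E) < T%:E)%E -> A <= rho * expR (T / L).
Proof.
move=> L0; rewrite le_eqVlt => /predU1P[<- r0 _|A0].
  by rewrite mulr_ge0// expR_ge0.
rewrite le_eqVlt => /predU1P[<-|r0].
  by rewrite inve0 gt0_muley ?lte_fin//= gt0_muley ?lte_fin.
rewrite inver gt_eqF// -EFinM lne_EFin ?divr_gt0// -EFinM lte_fin => H.
rewrite mulrC -ler_pdivrMr// -[leLHS]lnK ?posrE ?divr_gt0// ler_expR.
by rewrite ler_pdivlMr// mulrC ltW.
Qed.

End Threshold.

Section Constants.
Context (R : realType).
Implicit Types theta : R.

Lemma h11_low_gt0 theta : 0 < theta < 1 -> 0 < h11_low theta.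
Proof.
move=> /andP[t0 t1]; rewrite /h11_low mulr_gt0//; first by rewrite divr_gt0// exprn_gt0.
nra.
Qed.

(** The value of rho_0 is chosen so that h11_low rho_0 is the accumulated forcing
    of the recursion, once 1/eps is replaced by its upper bound. *)
Lemma rho0E Ceps nu lambda1 theta finf : 0 < nu -> 0 < lambda1 -> 0 < theta < 1 ->
  h11_low theta * rho0 Ceps nu lambda1 theta finf =
  Ceps / (2 * nu ^+ 2 * lambda1 ^+ 2) * finf ^+ 2.
Proof.
move=> nu0 l0 t01; have := h11_low_gt0 _ t01; case/andP: t01 => t0 t1.
rewrite /h11_low /rho0 => h0.
have : 0 < 1 - 1 / 2 * theta * (1 - theta) by nra.
move: (1 - 1 / 2 * theta * (1 - theta)) => q q0.
by field; rewrite !gt_eqF.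
Qed.

Lemma rho0_ge0 Ceps nu lambda1 theta finf :
  0 < Ceps -> 0 < nu -> 0 < lambda1 -> 0 < theta < 1 ->
  0 <= rho0 Ceps nu lambda1 theta finf.
Proof.
move=> C0 nu0 l0 t01; rewrite -(pmulr_rge0 _ (h11_low_gt0 _ t01)) rho0E//.
by rewrite mulr_ge0 ?sqr_ge0// divr_ge0 ?ltW// !mulr_gt0// exprn_gt0.
Qed.

End Constants.

Theorem corollary3p2 (R : realType)
  (C_h C_eps : R -> R)
  (Omega : set (R * R)) (nu lambda1 : R)
  (f : R -> vfield R)
  (theta dt : R)
  (u : nat -> vfield R) (Du : nat -> gfield R)
  (eps a b c h11 h22 : R) (N : nat) :
  C2_domain Omega ->
  0 < nu ->
  0 < lambda1 ->
  smallest_stokes_eigenvalue Omega lambda1 ->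
  poincare Omega lambda1 ->
  Linfty_H Omega f ->
  0 < theta < 1 ->
  0 < dt < C_dt nu lambda1 theta ->
  dln_scheme Omega nu theta dt f u Du ->
  bounded_samples Omega theta dt f ->
  0 < C_h theta ->
  0 < C_eps theta ->
  0 < eps ->
  0 < h11 ->
  0 < h22 ->
  GH_identity Omega nu lambda1 theta dt u eps a b c h11 h22 ->
  h11_low theta < h11 ->
  h22_low theta < h22 ->
  Num.max h11 h22 < C_h theta ->
  1 / 4 < 1 / eps < C_eps theta / (nu * lambda1 * dt) ->
  (Tstar (C_h theta) (C_eps theta) nu lambda1 theta
     (normL2 Omega (u 0%N)) (normL2 Omega (u 1%N)) (norm_infty Omega f)
   < ((N%:R - 1) * dt)%:E)%E ->
  normL2 Omega (u N) ^+ 2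
  <= 2 * rho0 (C_eps theta) nu lambda1 theta (norm_infty Omega f).
Proof.
move=> [oO _ _ _] nu0 l0 _ P [fH _ _] t01 /andP[dt0 _] S bS Ch0 Ce0 e0 h110 h220
  GH h11l _ hC /andP[e4 eC].
have hl := h11_low_gt0 _ _ t01.
set F := norm_infty Omega f in bS *; set rho := rho0 _ _ _ _ _.
have rho_ge0 : 0 <= rho by exact: rho0_ge0.
set x0 := normL2 Omega (u 0%N); set x1 := normL2 Omega (u 1%N).
set A := Chat_h (C_h theta) theta * (x1 ^+ 2 + x0 ^+ 2).
have C1 : h11_low theta < C_h theta.
  by apply: lt_trans h11l _; apply: le_lt_trans hC; rewrite le_max lexx.
have A0 : 0 <= A.
  by rewrite mulr_ge0 ?addr_ge0 ?sqr_ge0// divr_ge0// ltW.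
have L0 : 0 < 4 * C_eps theta / (nu * lambda1).
  by rewrite divr_gt0 ?mulr_gt0.
rewrite /Tstar -/rho -/A => /(lne_threshold _ _ _ _ _ L0 A0 rho_ge0).
have eps4 : eps < 4.
  by move: e4; rewrite !div1r ltf_pV2 ?posrE.
(* For N = 0 the threshold is negative, and Chat_h >= 1 bounds |u_0|^2 by A. *)
case: N => [|m] Arho.
  apply: (@le_trans _ _ A).
    rewrite /A -[leLHS]mul1r ler_pM ?sqr_ge0//.
      by rewrite /Chat_h ler_pdivlMr// mul1r ltW.
    by rewrite -/x0 lerDr sqr_ge0.
  apply: le_trans Arho _; rewrite mulrC ler_wpM2r//.
  apply: (@le_trans _ _ 1); last by lra.
  rewrite -[leRHS]expR0 ler_expR mulr0n sub0r mulN1r mulNr oppr_le0 divr_ge0// ltW//.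
pose H n := Hnorm2 Omega h11 h22 (u n.+1) (u n).
have step n : (1 + eps) * H n.+1 <= H n + dt / (2 * nu * lambda1) * F ^+ 2.
  apply: (energy_step _ _ oO _ _ _ _ _ _ _ _ _ _ _ _ _ _ _ nu0 l0 P t01 dt0 S _ _ GH).
    by have [] := fH _ (t_beta_ge0 _ _ _ n.+1 t01 (ltW dt0)).
  exact: bS.
have := discrete_gronwall _ _ _ _ e0 step m.
set K := _ * F ^+ 2; move=> GW.
have e1 : 0 < 1 + eps by rewrite addr_gt0.
have k0 : 0 <= K.
  by apply: mulr_ge0 (sqr_ge0 _); apply/ltW/divr_gt0; rewrite ?mulr_gt0.
have K0 : 0 <= K / eps by apply: divr_ge0 (ltW e0).
(* Accumulated forcing: the geometric series sums to K / eps. *)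
have Kr : K / eps <= h11_low theta * rho.
  rewrite rho0E// /K -/F.
  have -> : C_eps theta / (2 * nu ^+ 2 * lambda1 ^+ 2) * F ^+ 2 =
      dt / (2 * nu * lambda1) * F ^+ 2 * (C_eps theta / (nu * lambda1 * dt)).
    by field; rewrite !gt_eqF.
  by apply: ler_wpM2l => //; rewrite -div1r ltW.
(* 1/eps < C_eps / (nu lambda1 dt) compares the rate of T_* with eps / 4. *)
have growth : expR ((m.+1%:R - 1) * dt / (4 * C_eps theta / (nu * lambda1))) <=
    (1 + eps) ^+ m.
  have -> : (m.+1%:R - 1) * dt / (4 * C_eps theta / (nu * lambda1)) =
      m%:R * (nu * lambda1 * dt / C_eps theta / 4).
    by rewrite -natr1; field; rewrite !gt_eqF.
  rewrite expRM_natl; apply: lerXn2r; rewrite ?nnegrE ?expR_ge0 ?(ltW e1)//.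
  apply: le_trans (expR_quarter_le _ _ e0 eps4); rewrite ler_expR ler_pM2r ?invr_gt0//.
  rewrite ler_pdivrMr//; move: eC; rewrite ltr_pdivlMr ?mulr_gt0// mulrAC mul1r.
  by rewrite ltr_pdivrMr// [_ * eps]mulrC => /ltW.
have hA : h11_low theta * A = C_h theta * (x1 ^+ 2 + x0 ^+ 2).
  by rewrite /A /Chat_h; field; rewrite gt_eqF.
have H0A : H 0%N <= h11_low theta * A.
  move: hC; rewrite hA mulrDr gt_max => /andP[/ltW h1 /ltW h2].
  by rewrite /H /Hnorm2 -/x0 -/x1; apply: lerD; rewrite ler_wpM2r ?sqr_ge0.
have Hm : h11_low theta * normL2 Omega (u m.+1) ^+ 2 <= H m.
  rewrite /H /Hnorm2 -[leLHS]addr0; apply: lerD.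
    by rewrite ler_wpM2r ?sqr_ge0// ltW.
  by rewrite mulr_ge0 ?sqr_ge0// ltW.
rewrite -(ler_pM2l hl); apply: le_trans Hm _; apply: le_trans GW _.
have q0 : 0 <= (1 + eps) ^- m by rewrite invr_ge0 exprn_ge0// ltW.
have decay : (1 + eps) ^- m * H 0%N <= h11_low theta * rho.
  rewrite mulrC ler_pdivrMr ?exprn_gt0//; apply: le_trans H0A _.
  rewrite -[leRHS]mulrA (ler_pM2l hl); apply: le_trans Arho _.
  by rewrite ler_wpM2l.
have := mulr_ge0 q0 K0; lra.
Qed.
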